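(* Let $G$ be a homogeneous group with dilations $D_\lambda$ ($\lambda>0$), homogeneous dimension $Q$, and Haar measure $\mu$ normalized so that $\mu(B(x,r))=r^Q$ for all $x\in G$ and $r>0$. Let $\lambda:G\to(0,\infty)$ be a $\mu$-measurable function. If $\Phi\in L^1_{1/\lambda^Q}(G)$, then the Hausdorff operator $$(\mathcal{H}_{\Phi,\lambda}f)(x)=\int_G\Phi(u)f(D_{\lambda(u)}(x))\,d\mu(u)$$ is bounded on the real Hardy space $H^1(G)$, and $$\|\mathcal{H}_{\Phi,\lambda}\|\le2^Q\|\Phi\|_{L^1_{1/\lambda^Q}}.$$
   Context: A homogeneous group $G$ (in the sense of Folland and Stein) is a connected simply connected Lie group whose Lie algebra is equipped with dilations; these induce automorphisms $D_\lambda\in\mathrm{Aut}(G)$, $\lambda>0$. $G$ is endowed with a homogeneous (quasi-)norm: a continuous nonnegative function $|\cdot|$ on $G$ with $|x^{-1}|=|x|$, $|D_\lambda(x)|=\lambda|x|$ for all $x\in G$, $\lambda>0$, and $|x|=0$ if and only if $x=e$, the unit of $G$. The formula $\rho(x,y):=|y^{-1}x|$ defines a left invariant quasi-metric on $G$, and $B(x,r)$ is the corresponding quasi-ball of radius $r$ around $x$. The Haar measure $\mu$ is bi-invariant, and the homogeneous dimension $Q$ is the number for which $\mu$ can be normalized so that $\mu(B(x,r))=r^Q$. The kernel $\Phi$ is a locally integrable function on $G$; $\Phi\in L^1_{1/\lambda^Q}(G)$ means $\|\Phi\|_{L^1_{1/\lambda^Q}}:=\int_G|\Phi(u)|\lambda(u)^{-Q}\,d\mu(u)<\infty$.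 An atom on $G$ is a function $a$ such that (i) the support of $a$ is contained in a ball $B(x,r)$; (ii) $\|a\|_\infty\le1/\mu(B(x,r))$; (iii) $\int_Ga\,d\mu=0$. The real Hardy space $H^1(G)$ consists of the functions $f=\sum_j\lambda_ja_j$ with $a_j$ atoms, $\lambda_j$ scalars and $\sum_j|\lambda_j|<\infty$; $\|f\|_{H^1}$ is the infimum of $\sum_j|\lambda_j|$ over all such representations. $\|\mathcal{H}_{\Phi,\lambda}\|$ is the operator norm on $H^1(G)$. *)

(* Defs.v *)
(* The MathComp-Analysis library is used throughout. *)
From HB Require Import structures.
From mathcomp Require Import all_boot all_order all_algebra.
From mathcomp Require Import all_classical all_reals all_analysis.
From mathcomp Require Import ess_sup_inf complex.

Set Implicit Arguments.
Unset Strict Implicit.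
Unset Printing Implicit Defensive.

Import Order.TTheory GRing.Theory Num.Theory.
Import numFieldNormedType.Exports.

Local Open Scope classical_set_scope.
Local Open Scope ring_scope.

(* The joins below impose no compatibility between the structures: continuity
   of the group operations is part of [lie_group], and the link between the
   topology and the sigma-algebra is part of [haar_measure]. *)
#[short(type="topGroupType")]
HB.structure Definition TopGroup := {G of Group G & Topological G}.

#[short(type="measTopGroupType")]
HB.structure Definition MeasTopGroup d :=
  {G of Group G & Topological G & Measurable d G}.

Section smooth_maps.
Context {R : realType} {n : nat} {W : normedModType R}.

Fixpoint Ck (k : nat) (U : set 'rV[R]_n) (f : 'rV[R]_n -> W) : Prop :=
  match k with
  | 0%N => forall x, U x -> {for x, continuous f}
  | k'.+1 => (forall x, U x -> differentiable f x) /\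
             (forall v, Ck k' U (fun x => 'D_v f x))
  end.

Definition smooth_on (U : set 'rV[R]_n) (f : 'rV[R]_n -> W) : Prop :=
  open U /\ forall k, Ck k U f.

End smooth_maps.

Section lie_groups.
Context {R : realType} {G : topGroupType}.

(* [coord] and [param] are total functions, only meaningful on [dom] and on
   its image respectively. *)
Record chart (n : nat) := Chart {
  dom : set G;
  coord : G -> 'rV[R]_n;
  param : 'rV[R]_n -> G }.

Section fixed_dimension.
Context {n : nat}.
Implicit Types (c : chart n) (A : set (chart n)).

Definition ran c : set 'rV[R]_n := coord c @` dom c.

Definition is_chart c : Prop :=
  [/\ open (dom c), open (ran c),
      forall x, dom c x -> param c (coord c x) = x,
      forall x, dom c x -> {for x, continuous (coord c)} &
      forall v, ran c v -> {for v, continuous (param c)}].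

Definition smooth_transition c1 c2 : Prop :=
  smooth_on (coord c1 @` (dom c1 `&` dom c2)) (coord c2 \o param c1).

Definition compatible c A : Prop :=
  forall c', A c' -> smooth_transition c c' /\ smooth_transition c' c.

Definition smooth_atlas A : Prop :=
  [/\ forall c, A c -> is_chart c,
      forall x, exists2 c, A c & dom c x &
      forall c, A c -> compatible c A].

Definition smooth_map A (F : G -> G) : Prop :=
  continuous F /\ forall c1 c2, A c1 -> A c2 ->
    smooth_on (coord c1 @` (dom c1 `&` F @^-1` dom c2))
              (coord c2 \o F \o param c1).

(* Charts of G x G are products of charts of G, with values in R^(n + n). *)
Definition smooth_mul A : Prop :=
  continuous (fun z : G * G => (z.1 * z.2)%g) /\
  forall c1 c2 c3, A c1 -> A c2 -> A c3 ->
    let m (w : 'rV[R]_(n + n)) :=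
      (param c1 (lsubmx w) * param c2 (rsubmx w))%g in
    smooth_on [set w | [/\ ran c1 (lsubmx w), ran c2 (rsubmx w)
                         & dom c3 (m w)]]
              (coord c3 \o m).

Definition lie_group A : Prop :=
  [/\ hausdorff_space G /\ @second_countable G, smooth_atlas A, smooth_mul A
    & smooth_map A (fun x => x^-1)%g].

Definition smooth_fun A (f : G -> R) : Prop :=
  forall c, A c -> smooth_on (ran c) (f \o param c : 'rV[R]_n -> R^o).

(* Vector fields on G are derivations of the algebra of smooth functions; the
   value of such an operator on a non-smooth function is irrelevant. *)
Definition left_invariant_vf A (X : (G -> R) -> (G -> R)) : Prop :=
  [/\ forall f, smooth_fun A f -> smooth_fun A (X f),
      forall a f g, smooth_fun A f -> smooth_fun A g -> forall x,
        X (fun y => a * f y + g y) x = a * X f x + X g x,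
      forall f g, smooth_fun A f -> smooth_fun A g -> forall x,
        X (fun y => f y * g y) x = f x * X g x + X f x * g x &
      forall z f, smooth_fun A f -> forall x,
        X (fun y => f (z * y)%g) x = X f (z * x)%g].

(* [vf] is a linear isomorphism from R^n onto the Lie algebra of G, i.e. the
   choice of a basis of the left invariant vector fields. *)
Definition lie_algebra_basis A (vf : 'rV[R]_n -> (G -> R) -> (G -> R)) : Prop :=
  [/\ forall v, left_invariant_vf A (vf v),
      forall a u v f, smooth_fun A f -> forall x,
        vf (a *: u + v) f x = a * vf u f x + vf v f x,
      forall v, (forall f, smooth_fun A f -> forall x, vf v f x = 0) -> v = 0 &
      forall X, left_invariant_vf A X ->
        exists v, forall f, smooth_fun A f -> forall x, vf v f x = X f x].

Definition lie_bracket A (vf : 'rV[R]_n -> (G -> R) -> (G -> R))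
    (u v w : 'rV[R]_n) : Prop :=
  forall f, smooth_fun A f -> forall x,
    vf w f x = vf u (vf v f) x - vf v (vf u f) x.

(* The first two clauses characterise the exponential map: t |-> e (t u) is the
   one-parameter subgroup generated by the left invariant field vf u. The last
   one records that e is a diffeomorphism from a neighbourhood of 0 onto a
   neighbourhood of the unit, its local inverse being a chart of G. *)
Definition lie_exp A (vf : 'rV[R]_n -> (G -> R) -> (G -> R))
    (e : 'rV[R]_n -> G) : Prop :=
  [/\ forall u s t, e ((s + t) *: u) = (e (s *: u) * e (t *: u))%g,
      forall f, smooth_fun A f -> forall u x (t : R),
        is_derive t (1 : R) (fun s : R => f (x * e (s *: u))%g : R^o)
          (vf u f (x * e (t *: u))%g) &
      exists c : chart n,
        [/\ is_chart c, compatible c A, dom c 1%g, coord c 1%g = 0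
          & param c = e]].

(* [delta r] acts on row vectors on the right and equals exp (A log r) for
   A = P^-1 diag(d) P diagonalizable with positive eigenvalues d. *)
Definition lie_algebra_dilations A (vf : 'rV[R]_n -> (G -> R) -> (G -> R))
    (delta : R -> 'M[R]_n) : Prop :=
  (exists (P : 'M[R]_n) (d : 'I_n -> R),
    [/\ P \in unitmx, forall i, 0 < d i &
        forall r, 0 < r ->
          delta r = invmx P *m diag_mx (\row_i (r `^ d i)) *m P]) /\
  (forall r, 0 < r -> forall u v w, lie_bracket A vf u v w ->
     lie_bracket A vf (u *m delta r) (v *m delta r) (w *m delta r)).

(* [D r] is the automorphism of G with differential [delta r]. *)
Definition induced_dilations A (e : 'rV[R]_n -> G) (delta : R -> 'M[R]_n)
    (D : R -> G -> G) : Prop :=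
  forall r, 0 < r ->
    [/\ smooth_map A (D r), bijective (D r),
        forall x y, D r (x * y)%g = (D r x * D r y)%g &
        forall u, D r (e u) = e (u *m delta r)].

End fixed_dimension.

Definition simply_connected : Prop :=
  [/\ forall x y : G, exists g : R -> G,
        [/\ {within `[0, 1], continuous g}, g 0 = x & g 1 = y] &
      forall g : R -> G, {within `[0, 1], continuous g} -> g 0 = g 1 ->
        exists h : R * R -> G,
          [/\ {within `[0, 1] `*` `[0, 1], continuous h},
              forall t, t \in `[0, 1] -> h (0, t) = g t,
              forall t, t \in `[0, 1] -> h (1, t) = g 0 &
              forall s, s \in `[0, 1] -> h (s, 0) = g 0 /\ h (s, 1) = g 0]].

(* [D r] is only meaningful for r > 0. *)
Definition homogeneous_group (D : R -> G -> G) : Prop :=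
  [/\ connected [set: G], simply_connected &
      exists (n : nat) (A : set (chart n))
             (vf : 'rV[R]_n -> (G -> R) -> (G -> R)) (e : 'rV[R]_n -> G)
             (delta : R -> 'M[R]_n),
        [/\ lie_group A, lie_algebra_basis A vf, lie_exp A vf e,
            lie_algebra_dilations A vf delta &
            induced_dilations A e delta D]].

Definition homogeneous_norm (D : R -> G -> G) (N : G -> R) : Prop :=
  [/\ continuous N /\ (forall x, 0 <= N x),
      forall x, N (x^-1)%g = N x,
      forall r x, 0 < r -> N (D r x) = r * N x &
      forall x, N x = 0 <-> x = 1%g].

Definition rho (N : G -> R) (x y : G) : R := N (y^-1 * x)%g.

Definition qball (N : G -> R) (x : G) (r : R) : set G :=
  [set y | rho N y x < r].

End lie_groups.

Section haar.
Context {R : realType} {d : measure_display} {G : measTopGroupType d}.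

(* The measurable sets are the mu-measurable ones: the sigma-algebra is the
   mu-completion of the Borel sigma-algebra. On the second countable locally
   compact groups considered here, regularity is automatic. *)
Definition haar_measure (mu : {measure set G -> \bar R}) : Prop :=
  [/\ (forall U : set G, open U -> measurable U) /\
      measure_is_complete mu /\
      (forall A : set G, measurable A ->
         exists B : set G, [/\ <<s [set U : set G | open U] >> B, B `<=` A
                             & mu (A `\` B) = 0%E]),
      forall (x : G) (A : set G), measurable A ->
        mu [set (x * y)%g | y in A] = mu A,
      forall (x : G) (A : set G), measurable A ->
        mu [set (y * x)%g | y in A] = mu A,
      forall C : set G, compact C -> (mu C < +oo)%E &
      mu [set: G] <> 0%E].

End haar.

Section hardy.
Context {R : realType} {d : measure_display} {G : measTopGroupType d}.
Variables (mu : {measure set G -> \bar R}) (N : G -> R).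
Notation normc := ComplexField.Normc.normc.

Definition real_or_complex (K : set R[i]) : Prop :=
  K = [set: R[i]] \/ K = [set z | complex.Im z = 0].

Definition cmeasurable (f : G -> R[i]) : Prop :=
  measurable_fun [set: G] (fun x => complex.Re (f x)) /\
  measurable_fun [set: G] (fun x => complex.Im (f x)).

Definition cintegrable (A : set G) (f : G -> R[i]) : Prop :=
  cmeasurable f /\ (\int[mu]_(x in A) (normc (f x))%:E < +oo)%E.

Definition cintegral (f : G -> R[i]) : R[i] :=
  Complex (\int[mu]_x complex.Re (f x)) (\int[mu]_x complex.Im (f x)).

Definition locally_cintegrable (f : G -> R[i]) : Prop :=
  forall C : set G, compact C -> cintegrable C f.

(* In what follows K is the set of scalars, R or C (see [real_or_complex]). *)
Definition atom (K : set R[i]) (a : G -> R[i]) : Prop :=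
  [/\ forall x, K (a x), cmeasurable a &
      exists (x : G) (r : R),
        [/\ 0 < r,
            [set y | a y != 0] `<=` qball N x r,
            (ess_sup mu (fun y => (normc (a y))%:E)
               <= ((fine (mu (qball N x r)))^-1)%:E)%E &
            cintegral a = 0]].

(* As sum |c_j| is finite and atoms have L^1 norm at most 1, almost everywhere
   convergence of the series to f is the same as convergence in L^1. *)
Definition atomic_decomposition (K : set R[i]) (f : G -> R[i])
    (c : nat -> R[i]) (a : nat -> G -> R[i]) : Prop :=
  [/\ forall j, K (c j), forall j, atom K (a j),
      (\sum_(0 <= j <oo) (normc (c j))%:E < +oo)%E &
      {ae mu, forall x,
        (fun m : nat => normc (f x - \sum_(j < m) c j * a j x)) @ \oo
          --> (0 : R)}].

(* Elements of H^1 are represented by functions, defined up to equality almost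
   everywhere. *)
Definition H1 (K : set R[i]) : set (G -> R[i]) :=
  [set f | (forall x, K (f x)) /\ exists c a, atomic_decomposition K f c a].

Definition H1norm (K : set R[i]) (f : G -> R[i]) : \bar R :=
  ereal_inf [set s | exists c a, atomic_decomposition K f c a /\
                       s = (\sum_(0 <= j <oo) (normc (c j))%:E)%E].

Definition bounded_operator_H1 (K : set R[i])
    (T : (G -> R[i]) -> (G -> R[i])) : Prop :=
  [/\ forall f, H1 K f -> H1 K (T f),
      forall f g, H1 K f -> H1 K g -> {ae mu, forall x, f x = g x} ->
        {ae mu, forall x, T f x = T g x},
      forall k f g, K k -> H1 K f -> H1 K g ->
        {ae mu, forall x, T (fun y => k * f y + g y) x = k * T f x + T g x} &
      exists C : R, forall f, H1 K f ->
        (H1norm K (T f) <= C%:E * H1norm K f)%E].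

Definition opnorm_H1 (K : set R[i]) (T : (G -> R[i]) -> (G -> R[i])) : \bar R :=
  ereal_sup [set s | exists f, [/\ H1 K f, (H1norm K f <= 1)%E
                                 & s = H1norm K (T f)]].

Definition hausdorff_integrand (D : R -> G -> G) (Phi : G -> R[i])
    (lam : G -> R) (f : G -> R[i]) (x : G) : G -> R[i] :=
  fun u => Phi u * f (D (lam u) x).

Definition hausdorff_operator (D : R -> G -> G) (Phi : G -> R[i])
    (lam : G -> R) (f : G -> R[i]) : G -> R[i] :=
  fun x => cintegral (hausdorff_integrand D Phi lam f x).

(* The norm of the weighted space L^1_{1/lam^Q}. *)
Definition L1w_norm (Q : R) (lam : G -> R) (Phi : G -> R[i]) : \bar R :=
  (\int[mu]_u (normc (Phi u) * (lam u `^ Q)^-1)%:E)%E.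

End hardy.

(* Main.v *)
From HB Require Import structures.
Require Import Defs.
From mathcomp Require Import all_boot all_order all_algebra.
From mathcomp Require Import all_classical all_reals all_analysis.
From mathcomp Require Import measurable_realfun ess_sup_inf complex ring lra.
Import Order.TTheory GRing.Theory Num.Theory.
Import numFieldNormedType.Exports.
Local Open Scope classical_set_scope.
Local Open Scope ring_scope.
Set Implicit Arguments.
Unset Strict Implicit.
Unset Printing Implicit Defensive.

(** The dilations are written additively, S s = D (exp s), and the operator
    as T f (x) = int Phi(u) f(S (l u) x) du with l = log lam, so that the
    weight lam(u)^-Q is exp(- l u)^Q.

    If a is an atom carried by B(x0, r), then a o S s is carried by the ball
    of radius exp(-s) r around S (-s) x0 and exp(s Q) (a o S s) is again an
    atom. Formally T a is thus an average of atoms of total mass int |Phi|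
    lam^-Q. To avoid integrating with values in the Hardy space, the time
    axis is cut into intervals short enough that, for every t between 0 and
    their length, S t maps B(x0, r) into B(x0, 2r) ([flow_tube_exists]). The
    part of T a coming from the u with l u in an interval ending at s is then
    supported in one ball, of radius 2 exp(-s) r; it has mean zero by Fubini,
    and it is bounded by r^-Q int |Phi| over these u. Hence it is an atom
    times 2^Q int |Phi| lam^-Q, the integral over these u
    ([flow_piece_atom]): the constant 2^Q is the ratio of the volumes of
    B(x0, 2r) and B(x0, r), and summing over the intervals loses nothing
    more.

    For f = sum_j c_j a_j the pieces of all T a_j, each atom with its own
    subdivision, form a countable family of atoms whose coefficients add up
    to 2^Q |Phi| sum_j |c_j|. They sum almost everywhere to T f by dominated
    convergence: for almost every x the function u |-> sum_j |c_j Phi(u)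
    a_j(S (l u) x)| is integrable by Tonelli, and at fixed u exactly one
    piece of every T a_j is active ([hausdorff_atomic_decomposition_tube]).
    The bound on the H^1 norm follows by taking the infimum over the
    decompositions of f.

    Two facts about the group are needed. The flow S is jointly continuous
    and the closed balls of the homogeneous norm are compact: both are
    derived from an exponential chart at the unit, using that a connected
    group is generated by any neighbourhood of its unit
    ([homogeneous_group_flow]). And S s scales Haar measure by exp(s Q)
    ([haar_scaling]): this is known for balls only, and spreads to all sets
    by the uniqueness of Haar measure. Since the sigma-algebra is complete,
    while completeness is lost on products, functions are replaced by Borel
    representatives before Fubini is applied. *)

(** * Topological groups and matrices *)

Section connected_groups.
Context {G : topGroupType}.
Hypothesis mul_cont : continuous (fun z : G * G => (z.1 * z.2)%g).

Lemma mulg_cvg (T : Type) (F : set_system T) (FF : Filter F)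
  (f g : T -> G) a b :
  f @ F --> a -> g @ F --> b -> (fun x => (f x * g x)%g) @ F --> (a * b)%g.
Proof.
move=> fa gb; apply: (@cvg_comp _ _ _ (fun x => (f x, g x))
  (fun z : G * G => (z.1 * z.2)%g) _ (nbhs (a, b)));
  last exact: (@mul_cont (a, b)).
exact: cvg_pair.
Qed.

Lemma continuous_mull (a : G) : continuous (fun x : G => (a * x)%g).
Proof. by move=> x; apply: mulg_cvg; [exact: cvg_cst | exact: cvg_id]. Qed.

(** Such an H is open, and so is its complement, a union of cosets of H. This
    is how properties of the dilations visible near the unit reach all of G. *)
Lemma connected_group_ind (H : set G) : connected [set: G] ->
  nbhs 1%g H -> (forall x y, H x -> H y -> H (x * y)%g) ->
  (forall x, H x -> H x^-1%g) -> H = setT.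
Proof.
move=> cG H1 HM HV.
have near1 (x : G) : nbhs x [set y | H (x^-1 * y)%g].
  apply: (@continuous_mull x^-1%g x); by rewrite mulVg.
apply: cG.
- by exists 1%g; exact: nbhs_singleton.
- exists H; last by rewrite setTI.
  rewrite openE => x Hx; apply: filterS (near1 x) => y /= /(HM _ _ Hx).
  by rewrite mulgA mulgV mul1g.
- exists H; last by rewrite setTI.
  rewrite -[H]setCK; apply: open_closedC; rewrite openE => x nHx.
  apply: filterS (near1 x) => y /= Hxy Hy; apply: nHx.
  by rewrite -[x]mul1g -(mulgV y) -mulgA; apply: HM => //;
    rewrite -[(y^-1 * x)%g]invgK invgM invgK; exact: HV.
Qed.
End connected_groups.

Section row_topology.
Context {R : realType}.

Lemma cvg_mx (T : Type) (F : set_system T) (FF : Filter F) m n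
    (f : T -> 'M[R]_(m, n)) (M : 'M[R]_(m, n)) :
  (forall i j, (fun x => f x i j) @ F --> M i j) -> f @ F --> M.
Proof.
move=> fM A [P PM PA]; rewrite nbhs_simpl/=.
have : \forall x \near F, forall ij : 'I_m * 'I_n, P ij.1 ij.2 (f x ij.1 ij.2).
  by apply: filter_forall => -[i j]; exact: (fM i j _ (PM i j)).
by apply: filterS => x Px; apply: PA => i j; exact: (Px (i, j)).
Qed.

Lemma mulmx_cvg (T : Type) (F : set_system T) (FF : Filter F) m n p
    (f : T -> 'M[R]_(m, n)) (g : T -> 'M[R]_(n, p)) (A : 'M[R]_(m, n))
      (B : 'M[R]_(n, p)) :
  f @ F --> A -> g @ F --> B -> (fun x => f x *m g x) @ F --> A *m B.
Proof.
move=> fA gB; apply: cvg_mx => i j; rewrite mxE.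
under eq_fun do rewrite mxE.
apply: cvg_big => [|k _]; first exact: add_continuous.
have fk : f x i k @[x --> F] --> A i k.
  exact: (cvg_comp f (fun X : 'M[R]_(m, n) => X i k) fA
    (@coord_continuous _ _ _ i k A)).
have gk : g x k j @[x --> F] --> B k j.
  exact: (cvg_comp g (fun X : 'M[R]_(n, p) => X k j) gB
    (@coord_continuous _ _ _ k j B)).
exact: (cvgM fk gk).
Qed.
End row_topology.

(** * The dilations as a continuous flow of automorphisms *)

(** The family S of automorphisms is, in the chart c at the unit, the linear
    flow M. *)
Section exponential_chart.
Context {R : realType} {G : topGroupType} {n : nat}.
Variables (c : @chart R G n) (S : R -> G -> G) (M : R -> 'M[R]_n).
Hypothesis mul_cont : continuous (fun z : G * G => (z.1 * z.2)%g).
Hypothesis inv_cont : continuous (fun x : G => (x^-1)%g).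
Hypothesis cG : connected [set: G].
Hypothesis hc : is_chart c.
Hypothesis c1 : dom c 1%g.
Hypothesis c10 : Defs.coord c 1%g = 0.
Hypothesis SM : forall s x y, S s (x * y)%g = (S s x * S s y)%g.
Hypothesis Se : forall s u, S s (param c u) = param c (u *m M s).
Hypothesis M0 : M 0 = 1%:M.
Hypothesis MD : forall s t, M (s + t) = M s *m M t.
Hypothesis Mc : continuous M.
Hypothesis Mlim : M s @[s --> -oo] --> (0 : 'M[R]_n).

Let S1 s : S s 1%g = 1%g.
Proof. by apply: (@mulgI G (S s 1%g)); rewrite -SM !mulg1. Qed.

Let SV s x : S s (x^-1)%g = ((S s x)^-1)%g.
Proof. by apply/esym/mulg1_eq; rewrite -SM mulgV S1. Qed.

Let Sdom s x : dom c x -> S s x = param c (Defs.coord c x *m M s).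
Proof. by case: hc => _ _ pc _ _ cx; rewrite -Se pc. Qed.

Let nbhs_dom : nbhs 1%g (dom c).
Proof. by case: hc => oc _ _ _ _; exact: open_nbhs_nbhs. Qed.

Let coord_cvg1 : Defs.coord c x @[x --> (1%g : G)] --> (0 : 'rV[R]_n).
Proof. by rewrite -c10; case: hc => _ _ _ + _; exact. Qed.

Let ran0 : ran c 0. Proof. by exists 1%g. Qed.

Let param0 : param c 0 = 1%g.
Proof. by case: hc => _ _ pc _ _; rewrite -c10 pc. Qed.

Let param_cvg (T : Type) (F : set_system T) (FF : Filter F)
  (f : T -> 'rV[R]_n) :
  f @ F --> (0 : 'rV[R]_n) -> param c (f x) @[x --> F] --> (1%g : G).
Proof.
move=> f0; rewrite -param0; have h2 : param c v @[v --> (0 : 'rV[R]_n)]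
  --> param c 0.
  by case: hc => _ _ _ _; apply.
exact: (cvg_comp f (param c) f0 h2).
Qed.

Lemma flow_add s t x : S (s + t) x = S s (S t x).
Proof.
suff /seteqP[_ /(_ x I)] :
  [set x | S (s + t) x = S s (S t x)] = setT by [].
apply: connected_group_ind => //=.
- apply: filterS nbhs_dom => y cy /=.
  by rewrite !(Sdom _ cy) Se addrC MD mulmxA.
- by move=> y z /= yE zE; rewrite !SM yE zE.
- by move=> y /= yE; rewrite !SV yE.
Qed.

Lemma flow0 x : S 0 x = x.
Proof.
suff /seteqP[_ /(_ x I)] : [set x | S 0 x = x] = setT by [].
apply: connected_group_ind => //=.
- apply: filterS nbhs_dom => y cy /=.
  by rewrite Sdom// M0 mulmx1; case: hc => _ _ -> //.
- by move=> y z /= yE zE; rewrite !SM yE zE.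
- by move=> y /= yE; rewrite !SV yE.
Qed.

Let flow_cvg_unit (s0 : R) : S z.1 z.2 @[z --> ((s0, 1%g) : R * G)]
  --> (1%g : G).
Proof.
have : (param c (Defs.coord c z.2 *m M z.1)) @[z --> ((s0, 1%g) : R * G)]
  --> (1%g : G).
  apply: param_cvg; rewrite -(mul0mx _ (M s0)).
  apply: mulmx_cvg.
    exact: (cvg_comp (fun z : R * G => z.2) (Defs.coord c) cvg_snd coord_cvg1).
  exact: (cvg_comp (fun z : R * G => z.1) M cvg_fst (@Mc s0)).
apply: cvg_trans; apply: near_eq_cvg.
have : \forall z \near ((s0, 1%g) : R * G), dom c z.2.
  by apply: (@cvg_snd _ _ (nbhs s0) (nbhs (1%g : G))); exact: nbhs_dom.
by apply: filterS => z /(@Sdom z.1).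
Qed.

Let flow_cvg_time x (s0 : R) : S s x @[s --> s0] --> S s0 x.
Proof.
suff /seteqP[_ /(_ x I)] :
  [set x | S s x @[s --> s0] --> S s0 x] = setT by [].
apply: connected_group_ind => //=.
- have : \forall x \near (1%g : G), ran c (Defs.coord c x *m M s0).
    have : Defs.coord c x *m M s0 @[x --> (1%g : G)] --> (0 : 'rV[R]_n).
      rewrite -(mul0mx _ (M s0)); apply: mulmx_cvg; first exact: coord_cvg1.
      exact: cvg_cst.
    apply; case: hc => _ oc _ _ _; exact: open_nbhs_nbhs.
  move: nbhs_dom; apply: filterS2 => y cy ry /=.
  rewrite Sdom//; under eq_fun do rewrite Sdom//.
  have h1 : Defs.coord c y *m M s @[s --> s0] --> Defs.coord c y *m M s0.
    by apply: mulmx_cvg; [exact: cvg_cst|exact: Mc].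
  have h2 : param c v @[v --> Defs.coord c y *m M s0] -->
    param c (Defs.coord c y *m M s0).
    by case: hc => _ _ _ _; apply.
  exact: (cvg_comp _ (param c) h1 h2).
- move=> y z /= yE zE; rewrite SM; under eq_fun do rewrite SM.
  exact: mulg_cvg.
- move=> y /= yE; rewrite SV; under eq_fun do rewrite SV.
  exact: (cvg_comp _ (fun x : G => x^-1%g) yE (@inv_cont _)).
Qed.

(** Continuity at (s0, x0) follows from S s x = S s x0 * S s (x0^-1 * x): the
    first factor depends on the time only and the second one stays in the
    chart at the unit. *)
Lemma flow_continuous : continuous (fun z : R * G => S z.1 z.2).
Proof.
case=> s0 x0 /=.
have -> : (fun z : R * G => S z.1 z.2) =
    (fun z => S z.1 x0 * S z.1 (x0^-1 * z.2))%g.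
  by apply/funext => z; rewrite -SM mulVKg.
rewrite /continuous_at /= mulVg S1; apply: mulg_cvg => //.
  exact: (cvg_comp (fun z : R * G => z.1) (fun s => S s x0) cvg_fst
    (@flow_cvg_time x0 s0)).
have h2 : (x0^-1 * z.2)%g @[z --> ((s0, x0) : R * G)] --> (1%g : G).
  have := @mulg_cvg G mul_cont _ (nbhs ((s0, x0) : R * G)) _ (fun=> x0^-1%g)
    (fun z => z.2) x0^-1%g x0.
  rewrite mulVg; apply; first exact: cvg_cst.
  exact: cvg_snd.
have h : (z.1, (x0^-1 * z.2)%g) @[z --> ((s0, x0) : R * G)] -->
  ((s0, 1%g) : R * G).
  exact: (cvg_pair cvg_fst h2).
exact: (cvg_comp _ (fun z : R * G => S z.1 z.2) h (@flow_cvg_unit s0)).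
Qed.

Lemma flow_contracts x : S s x @[s --> -oo] --> (1%g : G).
Proof.
suff /seteqP[_ /(_ x I)] : [set x | S s x @[s --> -oo] --> (1%g : G)]
  = setT by [].
apply: connected_group_ind => //=.
- apply: filterS nbhs_dom => y cy /=; under eq_fun do rewrite Sdom//.
  apply: param_cvg; rewrite -(mulmx0 _ (Defs.coord c y)).
  by apply: mulmx_cvg; [exact: cvg_cst|exact: Mlim].
- move=> y z /= yE zE; under eq_fun do rewrite SM.
  suff : (S s y * S s z)%g @[s --> -oo] --> (1 * 1 : G)%g by rewrite
    mulg1; apply.
  exact: mulg_cvg.
- move=> y /= yE; under eq_fun do rewrite SV.
  suff : (S s y)^-1%g @[s --> -oo] --> (1^-1 : G)%g by rewrite invg1; apply.
  exact: (cvg_comp _ (fun x : G => x^-1%g) yE (@inv_cont _)).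
Qed.

End exponential_chart.

Section compact_balls.
Context {R : realType} {G : topGroupType} {n : nat}.
Variables (c : @chart R G n) (S : R -> G -> G) (N : G -> R).
Hypothesis hausG : hausdorff_space G.
Hypothesis hc : is_chart c.
Hypothesis c1 : dom c 1%g.
Hypothesis c10 : Defs.coord c 1%g = 0.
Hypothesis SD : forall s t x, S (s + t) x = S s (S t x).
Hypothesis S0 : forall x, S 0 x = x.
Hypothesis S_cont : continuous (fun z : R * G => S z.1 z.2).
Hypothesis S_lim : forall x, S s x @[s --> -oo] --> (1%g : G).
Hypothesis N_cont : continuous N.
Hypothesis N_ge0 : forall x, 0 <= N x.
Hypothesis N_eq0 : forall x, N x = 0 -> x = 1%g.
Hypothesis NS : forall s x, N (S s x) = expR s * N x.

Let S_time x : continuous (S^~ x).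
Proof.
move=> s; have h : (t, x) @[t --> s] --> ((s, x) : R * G).
  exact: (cvg_pair cvg_id (cvg_cst x)).
exact: (cvg_comp _ (fun z : R * G => S z.1 z.2) h (@S_cont (s, x))).
Qed.

Let S_space s : continuous (S s).
Proof.
move=> x; have h : (s, y) @[y --> x] --> ((s, x) : R * G).
  exact: (cvg_pair (cvg_cst s) cvg_id).
exact: (cvg_comp _ (fun z : R * G => S z.1 z.2) h (@S_cont (s, x))).
Qed.

Lemma compact_nbhs_unit : exists K : set G, compact K /\ nbhs 1%g K.
Proof.
case: hc => od or pc cc pcont.
have ran0 : ran c 0 by exists 1%g.
have /nbhs_closedballP[e] : nbhs (0 : 'rV[R]_n) (ran c) by
  exact: open_nbhs_nbhs.
set B := closed_ball _ _ => Br.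
exists (param c @` B); split.
  apply: continuous_compact.
    move=> v; apply/continuous_in_subspaceT => w; rewrite inE => /Br;
      exact: pcont.
  apply: bounded_closed_compact; last exact: closed_ball_closed.
  exists e%:num; split; first by rewrite num_real.
  move=> M eM v; rewrite /B closed_ballE// /closed_ball_/= sub0r normrN => ve.
  exact: le_trans (ltW eM).
have : nbhs (1%g : G) (Defs.coord c @^-1` B).
  by apply: (cc _ c1); rewrite c10;
    apply: (filterS (@subset_closed_ball _ _ (0 : 'rV[R]_n) e%:num));
    exact: nbhsx_ballx.
have : nbhs (1%g : G) (dom c) by exact: open_nbhs_nbhs.
by apply: filterS2 => x dx Bx; exists (Defs.coord c x) => //; exact: pc.
Qed.

(** Let K be a compact neighbourhood of the unit, and let m > 0 be a strict
    lower bound of N on the boundary of K. If N x <= m, the line s |-> S s x,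
    s <= 0, comes from the unit and N stays at most m along it, so it cannot
    cross that boundary: hence x is in K. Every ball is contained in an image
    of this one under the flow. *)
Lemma compact_norm_ball r : compact [set x | N x <= r].
Proof.
have [K [cK K1]] := compact_nbhs_unit.
have clK : closed K := compact_closed hausG cK.
pose L := K `\` K°.
have cL : compact L.
  apply: (subclosed_compact _ cK); last exact: subDsetl.
  by apply: closedI => //; apply: open_closedC; exact: open_interior.
have [m m0 Lm] : exists2 m : R, 0 < m & forall x, L x -> m < N x.
  have /compact_near_coveringP cov := cL.
  have : \forall m \near (0 : R)^'+, L `<=` [set x | m < N x].
    apply: cov => x [_ Kx].
    have Nx : 0 < N x.
      rewrite lt_def N_ge0 andbT; apply/eqP => /N_eq0 x1; apply: Kx.
      by rewrite x1; exact: K1.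
    have N2 : N x / 2 < N x by rewrite ltr_pdivrMr// ltr_pMr// ltr1n.
    have Nnear : \forall y \near x, N x / 2 < N y by
      exact: (@N_cont x _ (lt_nbhsr N2)).
    near=> y m => /=; apply: (@lt_trans _ _ (N x / 2)).
      by near: m; apply: nbhs_right_lt; rewrite divr_gt0.
    by near: y; exact: Nnear.
  move=> h; near (0 : R)^'+ => m; exists m; first by [].
  by near: m; apply: filterS h => m mL x /mL.
have NmK : [set x | N x <= m] `<=` K.
  move=> x /= Nx; apply: contrapT => nKx.
  pose I := `]-oo, (0 : R)]%classic.
  have cI : connected I by apply/connected_intervalP;
    exact: interval_is_interval.
  have IL s : I s -> ~ L (S s x).
    rewrite /I/= in_itv/= => s0 /Lm; rewrite NS ltNge => /negP; apply.
    apply: le_trans Nx; rewrite -[leRHS]mul1r ler_wpM2r//.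
    by rewrite -expR0 ler_expR.
  have : I `&` [set s | K° (S s x)] = I.
    apply: cI.
    - have Snear : \forall s \near -oo_R, K° (S s x) by
        exact: (@S_lim x _ (nbhs_interior K1)).
      near -oo_R => s; exists s; split.
        by rewrite /I/= in_itv/=; near: s; exact: nbhs_ninfty_le.
      by near: s; exact: Snear.
    - exists [set s | K° (S s x)] => //.
      by apply: open_comp; [move=> s _; exact: S_time | exact: open_interior].
    - exists [set s | K (S s x)].
        by apply: closed_comp => //; move=> s _; exact: S_time.
      apply/seteqP; split => s [Is]; first by move=> /interior_subset.
      by move=> Ks; split => //; apply: contrapT => nKs; exact: (IL s).
  move=> /seteqP[_ /(_ 0)] []; first by rewrite /I/= in_itv/=.
  by move=> _ /=; rewrite S0 => /interior_subset.
have clN t : closed [set x | N x <= t].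
  by apply: (closed_comp (D := [set y : R | y <= t])) => [x _|];
    [exact: N_cont | exact: closed_le].
have cm : compact [set x | N x <= m] by exact: subclosed_compact NmK.
have [s sr] : exists s, r <= expR s * m.
  exists (ln (Num.max 1 (r / m))); rewrite lnK;
    last by rewrite posrE lt_max ltr01.
  by rewrite -ler_pdivrMr// le_max lexx orbT.
have cB := continuous_compact (continuous_subspaceT (@S_space s)) cm.
apply: (subclosed_compact (clN r) cB) => x /= Nx.
exists (S (- s) x); last by rewrite -SD subrr S0.
by rewrite /= NS expRN ler_pdivrMl ?expR_gt0//; exact: le_trans sr.
Unshelve. all: by end_near. Qed.

End compact_balls.

(** What the Lie structure provides for the analysis. With an additive time
    the flow is continuous on all of R * G, with no restriction to positive
    parameters. *)
Record dilation_flow {R : realType} {G : topGroupType} (S : R -> G -> G)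
    (N : G -> R) : Prop := DilationFlow {
  flow_second_countable : @second_countable G;
  flow_mul_cont : continuous (fun z : G * G => (z.1 * z.2)%g);
  flow_inv_cont : continuous (fun x : G => (x^-1)%g);
  flow_morph : forall s x y, S s (x * y)%g = (S s x * S s y)%g;
  flow_action : forall s t x, S (s + t) x = S s (S t x);
  flow_id : forall x, S 0 x = x;
  flow_cont : continuous (fun z : R * G => S z.1 z.2);
  flow_norm_cont : continuous N;
  flow_normV : forall x, N (x^-1)%g = N x;
  flow_normS : forall s x, N (S s x) = expR s * N x;
  flow_compact_ball : forall r, compact [set x | N x <= r] }.

Lemma conjmxM {R : comUnitRingType} {n : nat} (P A B : 'M[R]_n) :
  P \in unitmx ->
  invmx P *m (A *m B) *m P = (invmx P *m A *m P) *m (invmx P *m B *m P).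
Proof. by move=> Pu; rewrite -!mulmxA (mulKVmx Pu). Qed.

Section diagonal_dilations.
Context {R : realType} {n : nat} (P : 'M[R]_n) (d : 'I_n -> R).
Hypothesis Pu : P \in unitmx.
Hypothesis d_gt0 : forall i, 0 < d i.

Let E (s : R) : 'M[R]_n := diag_mx (\row_i (expR s `^ d i)).

Let E_cvg (F : set_system R) (FF : Filter F) (v : 'rV[R]_n) :
  (forall i, expR s `^ d i @[s --> F] --> v ord0 i) -> E s @[s --> F]
    --> diag_mx v.
Proof.
move=> h; apply: cvg_mx => i j; rewrite mxE.
have -> : (fun s => E s i j) = (fun s => (expR s `^ d i) *+ (i == j)).
  by apply/funext => s; rewrite /E !mxE.
by case: (i == j) => /=; [exact: h|rewrite mulr0n; exact: cvg_cst].
Qed.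

Lemma conj_diag_flow0 : invmx P *m E 0 *m P = 1%:M.
Proof.
have -> : E 0 = 1%:M.
  by apply/matrixP => i j; rewrite /E !mxE expR0 powR1.
by rewrite mulmx1 mulVmx.
Qed.

Lemma conj_diag_flowD s t :
  invmx P *m E (s + t) *m P = (invmx P *m E s *m P) *m (invmx P *m E t *m P).
Proof.
rewrite -conjmxM//; congr (_ *m _ *m _).
rewrite mulmx_diag; congr diag_mx; apply/rowP => i.
by rewrite !mxE expRD (powRM (d i) (expR_ge0 s) (expR_ge0 t)).
Qed.

Lemma conj_diag_flow_continuous : continuous (fun s => invmx P *m E s *m P).
Proof.
move=> s0; apply: mulmx_cvg; last exact: cvg_cst.
apply: mulmx_cvg; first exact: cvg_cst.
apply: E_cvg => i; rewrite mxE; under eq_fun do rewrite -expRM.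
rewrite -expRM.
have h : s * d i @[s --> s0] --> s0 * d i by apply: cvgM;
  [exact: cvg_id|exact: cvg_cst].
exact: (cvg_comp _ expR h (@continuous_expR R _)).
Qed.

Lemma conj_diag_flow_lim :
  invmx P *m E s *m P @[s --> -oo] --> (0 : 'M[R]_n).
Proof.
have -> : (0 : 'M[R]_n) = invmx P *m diag_mx 0 *m P.
  by rewrite linear0 mulmx0 mul0mx.
apply: mulmx_cvg; last exact: cvg_cst.
apply: mulmx_cvg; first exact: cvg_cst.
apply: E_cvg => i; rewrite mxE; under eq_fun do rewrite -expRM.
have h : - (s * d i) @[s --> -oo] --> +oo.
  apply/cvgryPge => A; near=> s.
  rewrite lerNr -ler_pdivlMr//; near: s; exact: nbhs_ninfty_le.
have := cvg_comp _ _ h (@cvgr_expR R).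
by apply: cvg_trans; apply: near_eq_cvg; near=> s => /=; rewrite opprK.
Unshelve. all: by end_near. Qed.

End diagonal_dilations.

Lemma homogeneous_group_flow {R : realType} {G : topGroupType}
    (D : R -> G -> G) (N : G -> R) :
  homogeneous_group D -> homogeneous_norm D N ->
  dilation_flow (fun s => D (expR s)) N.
Proof.
case=> cG _ [n [A [vf
  [e [delta [lieG _ [_ _ [c [hc _ c1 c10 pe]]] [[P [d [Pu d0 dE]]] _] hD]]]]]].
case: lieG => [[hausG scG] _ [mulc _] [invc _]] [[Nc N0] NV ND N1].
pose S (s : R) := D (expR s); pose M (s : R) := delta (expR s).
have ME : M = (fun s => invmx P *m diag_mx (\row_i (expR s `^ d i)) *m P).
  by apply/funext => s; rewrite /M dE ?expR_gt0.
have SM s x y : S s (x * y)%g = (S s x * S s y)%g.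
  by have [_ _ + _] := hD _ (expR_gt0 s); apply.
have Se s u : S s (param c u) = param c (u *m M s).
  by rewrite pe; have [_ _ _] := hD _ (expR_gt0 s); apply.
have M0 : M 0 = 1%:M by rewrite ME; exact: conj_diag_flow0.
have MD s t : M (s + t) = M s *m M t by rewrite ME; exact: conj_diag_flowD.
have Mc : continuous M by rewrite ME; exact: conj_diag_flow_continuous.
have Ml : M s @[s --> -oo] --> (0 : 'M[R]_n) by rewrite ME;
  exact: conj_diag_flow_lim.
have SD := flow_add mulc cG hc c1 SM Se MD.
have S0 := flow0 mulc cG hc c1 SM Se M0.
have Sc := flow_continuous mulc invc cG hc c1 c10 SM Se Mc.
have Sl := flow_contracts mulc invc cG hc c1 c10 SM Se Ml.
have NS s x : N (S s x) = expR s * N x by rewrite ND ?expR_gt0.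
split=> //.
have N1' x : N x = 0 -> x = 1%g by move/N1.
exact: (compact_norm_ball hausG hc c1 c10 SD S0 Sc Sl Nc N0 N1' NS).
Qed.

(** * Measurability through countable bases *)

Lemma countable_bigcup_in_measurable d (T : measurableType d) (U : Type)
    (D : set U) (F : U -> set T) : countable D ->
  (forall i, D i -> measurable (F i)) -> measurable (\bigcup_(i in D) F i).
Proof.
move=> /pfcard_geP [->|[f]] mF; first by rewrite bigcup_set0.
rewrite (reindex_bigcup f setT); last 2 first.
- by move=> n _; exact: funS.
- exact: surj.
by apply: bigcupT_measurable => n; apply: mF; exact: funS.
Qed.

Lemma second_countable_real {R : realType} : @second_countable R.
Proof.
pose f (q : rat * rat) : set R := `](ratr q.1 : R), ratr q.2[%classic.
exists (range f); first exact: card_le_trans (card_image_le _ _) (countableP _).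
split; first by move=> _ [q _ <-]; exact: interval_open.
move=> x V /nbhs_ballP[e /= e0 eV].
have [q1] : exists q : rat, ratr q \in `]x - e, x[ by apply: rat_in_itvoo;
  rewrite ltrBlDr ltrDl.
have [q2] : exists q : rat, ratr q \in `]x, x + e[ by apply: rat_in_itvoo;
  rewrite ltrDl.
rewrite !in_itv/= => /andP[xq2 q2e] /andP[eq1 q1x].
exists (f (q1, q2)).
  by split; [exists (q1, q2)|rewrite /f/= in_itv/= q1x].
move=> y; rewrite /f/= in_itv/= => /andP[q1y yq2]; apply: eV.
by rewrite /ball/= ltr_distl ltrBlDr -[x < _]ltrBlDr (lt_trans yq2 q2e)
  (lt_trans eq1 q1y).
Qed.

Section product_preimages.
Context {X Y Z : topologicalType} {d} {T : measurableType d}.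
Variables (phi : X * Y -> Z) (p : T -> X) (q : T -> Y).
Hypothesis sX : @second_countable X.
Hypothesis sY : @second_countable Y.
Hypothesis phi_cont : continuous phi.
Hypothesis mp : forall U, open U -> measurable (p @^-1` U).
Hypothesis mq : forall U, open U -> measurable (q @^-1` U).

(** An open set of the product is a countable union of products of basic open
    sets, so measurability passes through continuous functions of two
    variables. *)
Lemma measurable_preimage_open (O : set Z) : open O ->
  measurable [set t | O (phi (p t, q t))].
Proof.
move=> oO; case: sX => BX cBX [oBX bX]; case: sY => BY cBY [oBY bY].
pose I := [set AB : set X * set Y |
  [/\ BX AB.1, BY AB.2 & AB.1 `*` AB.2 `<=` phi @^-1` O]].
have cI : countable I.
  apply: (@sub_countable _ _ _ (BX `*` BY)); last exact: countableX.
  by apply: subset_card_le => -[A B] [].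
have -> : [set t | O (phi (p t, q t))] =
    \bigcup_(AB in I) (p @^-1` AB.1 `&` q @^-1` AB.2).
  apply/seteqP; split => [t /= Ot|t [[A B] [/= _ _ ABO] [At Bt]]]; last first.
    exact: ABO.
  have : nbhs (p t, q t) (phi @^-1` O).
    by apply: phi_cont; exact: open_nbhs_nbhs.
  case=> -[P Q] /= [/bX[A [BA At] AP] /bY[B [BB Bt] BQ]] PQ.
  exists (A, B) => //; split => //= -[x y] [/= /AP Px /BQ Qy]; exact: PQ.
apply: countable_bigcup_in_measurable => // -[A B] [/= BA BB _].
by apply: measurableI; [apply/mp/oBX|apply/mq/oBY].
Qed.

End product_preimages.

Definition borel_set {G : topologicalType} : set (set G) :=
  <<s [set U : set G | open U] >>.

Lemma measurable_preimage_borel {Z : topologicalType} {d}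
    {T : measurableType d} (f : T -> Z) :
  (forall U, open U -> measurable (f @^-1` U)) ->
  forall B, borel_set B -> measurable (f @^-1` B).
Proof.
move=> mf; apply: smallest_sub => //; split.
- by rewrite /= preimage_set0.
- by move=> A /= mA; exact: (measurableD measurableT mA).
- move=> F mF /=; rewrite preimage_bigcup; exact: bigcupT_measurable.
Qed.

(** * Haar measure under dilations *)

Section haar_sigma_finite.
Context {R : realType} {d : measure_display} {G : measTopGroupType d}.
Variables (S : R -> G -> G) (N : G -> R) (Q : R).
Hypothesis fl : dilation_flow S N.

Lemma flow_unit s : S s 1%g = 1%g.
Proof. by apply: (@mulgI G (S s 1%g)); rewrite -(flow_morph fl) !mulg1. Qed.

Lemma flowV s x : S s (x^-1)%g = ((S s x)^-1)%g.
Proof. by apply/esym/mulg1_eq; rewrite -(flow_morph fl) mulgV flow_unit. Qed.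

Lemma flowKN s x : S s (S (- s) x) = x.
Proof. by rewrite -(flow_action fl) subrr (flow_id fl). Qed.

Lemma continuous_flow s : continuous (S s).
Proof.
move=> x; have h : (s, y) @[y --> x] --> ((s, x) : R * G).
  exact: (cvg_pair (cvg_cst s) cvg_id).
exact: (cvg_comp _ (fun z : R * G => S z.1 z.2) h
  (@flow_cont _ _ _ _ fl (s, x))).
Qed.

Lemma open_qball x r : open (qball N x r).
Proof.
apply: (@open_comp _ _ (fun y => N (x^-1 * y)%g) [set t : R | t < r]).
  move=> y _; have := @continuous_mull G (@flow_mul_cont _ _ _ _ fl) x^-1%g y.
  by move=> /continuous_comp; apply; exact: (flow_norm_cont fl).
exact: open_lt.
Qed.

Lemma flow_preimage_qball s x r :
  S s @^-1` (qball N x r) = qball N (S (- s) x) (expR (- s) * r).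
Proof.
have E y : (x^-1 * S s y)%g = S s ((S (- s) x)^-1 * y)%g.
  by rewrite (flow_morph fl) flowV flowKN.
apply/seteqP; split => y; rewrite /qball /rho /= E (flow_normS fl) expRN.
  by rewrite ltr_pdivlMl ?expR_gt0.
by rewrite ltr_pdivlMl ?expR_gt0.
Qed.

Variable mu : {measure set G -> \bar R}.
Hypothesis hmu : haar_measure mu.
Hypothesis hQ : forall (x : G) (r : R), 0 < r -> mu (qball N x r) = (r `^ Q)%:E.

Lemma open_haar_measurable (U : set G) : open U -> measurable U.
Proof. by case: hmu => -[+ _] _ _ _ _; apply. Qed.

Lemma haar_sigma_finite : sigma_finite [set: G] mu.
Proof.
exists (fun n => qball N 1%g n.+1%:R).
  apply/seteqP; split => // x _; exists (Num.truncn (N (1^-1 * x)%g)) => //.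
  by rewrite /qball /rho /=; exact: truncnS_gt.
move=> n; split; first exact/open_haar_measurable/open_qball.
by rewrite hQ// ltry.
Qed.

Lemma haar_dim_ge0 : 0 <= Q.
Proof.
have : (mu (qball N 1%g 1) <= mu (qball N 1%g 2))%E.
  apply: le_measure; rewrite ?inE; [exact/open_haar_measurable/open_qball..|].
  by move=> x; rewrite /qball /= => /lt_le_trans; apply; rewrite ler1n.
rewrite !hQ// lee_fin powR1 /powR pnatr_eq0/= -[leLHS]expR0 ler_expR.
by rewrite pmulr_lge0// ln_gt0// ltr1n.
Qed.

End haar_sigma_finite.

Section haar_scaling.
Local Open Scope ereal_scope.
Context {R : realType} {d : measure_display} {G : measTopGroupType d}.
Variables (S : R -> G -> G) (N : G -> R) (Q : R).
Variable mu : {sigma_finite_measure set G -> \bar R}.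
Hypothesis fl : dilation_flow S N.
Hypothesis hmu : haar_measure mu.
Hypothesis hQ : forall (x : G) (r : R), (0 < r)%R -> mu (qball N x r)
  = (r `^ Q)%:E.

Lemma borel_haar_measurable (B : set G) : borel_set B -> measurable B.
Proof.
by apply: (@measurable_preimage_borel G d G id) => U
  /(open_haar_measurable hmu).
Qed.

Lemma haar_mull (a : G) (A : set G) : measurable A ->
  mu [set y | A (a * y)%g] = mu A.
Proof.
move=> mA; case: hmu => _ + _ _ _ => /(_ a^-1%g A mA) <-; congr (mu _).
apply/seteqP; split => [y Ay|_ [y Ay <-]] /=; last by rewrite mulVKg.
by exists (a * y)%g => //; rewrite mulKg.
Qed.

Lemma haar_mulr (a : G) (A : set G) : measurable A ->
  mu [set y | A (y * a)%g] = mu A.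
Proof.
move=> mA; case: hmu => _ _ + _ _ => /(_ a^-1%g A mA) <-; congr (mu _).
apply/seteqP; split => [y Ay|_ [y Ay <-]] /=; last by rewrite mulgVK.
by exists (y * a)%g => //; rewrite mulgK.
Qed.

Let measurable_fst_open (U : set G) : open U -> measurable ((@fst G G) @^-1` U).
Proof.
move=> /(open_haar_measurable hmu) mU.
by rewrite -[X in measurable X]setTI; exact: measurable_fst.
Qed.

Let measurable_snd_open (U : set G) : open U -> measurable ((@snd G G) @^-1` U).
Proof.
move=> /(open_haar_measurable hmu) mU.
by rewrite -[X in measurable X]setTI; exact: measurable_snd.
Qed.

Lemma measurable_continuous2 (phi : G * G -> G) : continuous phi ->
  forall B, borel_set B -> measurable (phi @^-1` B).
Proof.
move=> cphi; apply: measurable_preimage_borel => U oU.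
have := measurable_preimage_open (flow_second_countable fl)
  (flow_second_countable fl) cphi measurable_fst_open measurable_snd_open oU.
by congr measurable; apply/seteqP; split => -[].
Qed.

Lemma ysection_integral_xsection (W : set (G * G)) : measurable W ->
  \int[mu]_x mu (xsection W x) = \int[mu]_y mu (ysection W y).
Proof.
move=> mW; have := indic_fubini_tonelli mu mu mW.
by rewrite indic_fubini_tonelli_FE// indic_fubini_tonelli_GE.
Qed.

Let integral_indicM (A : set G) (c : \bar R) : measurable A -> 0 <= c ->
  \int[mu]_x ((\1_A x)%:E * c) = mu A * c.
Proof.
move=> mA c0; rewrite ge0_integralZr//; last exact/measurable_EFinP.
by rewrite integral_indic// setIT.
Qed.

(** This is the uniqueness of Haar measure, applied to A |-> mu (S s @^-1`
    A). Let B be the unit ball, which is symmetric. The sets W1 of the (x, y)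
    with x in B and x * S s y in A, and W2 of the (x, y) with x in A and x *
    (S s y)^-1 in B have the same product measure, since at fixed y they
    differ by a right translation. At fixed x, left or right invariance gives
    the sections the measures mu (S s @^-1` A) for x in B, and mu (S s @^-1`
    B) for x in A. *)
Lemma haar_scaling_borel s (A : set G) : borel_set A ->
  mu (S s @^-1` A) = (expR (- s) `^ Q)%:E * mu A.
Proof.
move=> bA; pose B := qball N 1%g 1%R.
have oB : open B := open_qball fl 1%g 1.
have bB : borel_set B by exact: sub_sigma_algebra.
have mB := borel_haar_measurable bB.
have mA := borel_haar_measurable bA.
have muB : mu B = 1 by rewrite hQ// powR1.
have mS C : borel_set C -> measurable (S s @^-1` C).
  apply: measurable_preimage_borel => U oU; apply: (open_haar_measurable hmu).
  by apply: open_comp => // y _; exact: (continuous_flow fl).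
have muSB : mu (S s @^-1` B) = (expR (- s) `^ Q)%:E.
  rewrite (flow_preimage_qball fl) mulr1.
  by rewrite hQ ?expR_gt0.
have cS2 : continuous (fun z : G * G => S s z.2).
  move=> z; exact: (cvg_comp (fun z : G * G => z.2) (S s) cvg_snd
    (continuous_flow fl (x:=z.2))).
have cfst : continuous (fun z : G * G => z.1) by move=> z; exact: cvg_fst.
have mulc := @flow_mul_cont _ _ _ _ fl.
have cm1 : continuous (fun z : G * G => z.1 * S s z.2)%g.
  move=> z; apply: mulg_cvg => //; [exact: cfst|exact: cS2].
have cm2 : continuous (fun z : G * G => z.1 * (S s z.2)^-1)%g.
  move=> z; apply: mulg_cvg => //; [exact: cfst|].
  exact: (cvg_comp (fun z : G * G => S s z.2) (fun x : G => x^-1%g) (cS2 z)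
    (@flow_inv_cont _ _ _ _ fl _)).
pose W1 := [set z : G * G | B z.1 /\ A (z.1 * S s z.2)%g].
pose W2 := [set z : G * G | A z.1 /\ B (z.1 * (S s z.2)^-1)%g].
have mW1 : measurable W1.
  by apply: measurableI;
    [exact: (measurable_continuous2 cfst)|exact: (measurable_continuous2 cm1)].
have mW2 : measurable W2.
  by apply: measurableI;
    [exact: (measurable_continuous2 cfst)|exact: (measurable_continuous2 cm2)].
have -> : mu (S s @^-1` A) = \int[mu]_x mu (xsection W1 x).
  transitivity (\int[mu]_x ((\1_B x)%:E * mu (S s @^-1` A))).
    by rewrite integral_indicM// muB mul1e.
  apply: eq_integral => x _; rewrite indicE.
  have [xB|xB] := boolP (x \in B); last first.
    rewrite mul0e (_ : xsection W1 x = set0) ?measure0//.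
    apply/seteqP; split => // y; rewrite /xsection/= inE => -[] /=.
    by rewrite notin_setE in xB.
  rewrite mul1e -[LHS](haar_mull (S (- s) x)); last exact: mS.
  congr (mu _).
  rewrite inE in xB.
  apply/seteqP; split => y; rewrite /xsection/= inE (flow_morph fl) (flowKN fl).
    by split.
  by case.
rewrite (ysection_integral_xsection mW1).
transitivity (\int[mu]_y mu (ysection W2 y)).
  apply: eq_integral => y _; rewrite -[RHS](haar_mulr (S s y));
    last exact: measurable_ysection.
  congr (mu _); apply/seteqP; split => x; rewrite /ysection /= !inE /W1 /W2 /=
    mulgK; by case.
rewrite -(ysection_integral_xsection mW2) muleC -muSB -integral_indicM//.
apply: eq_integral => x _; rewrite indicE.
have [xA|xA] := boolP (x \in A); last first.
  rewrite mul0e (_ : xsection W2 x = set0) ?measure0//.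
  apply/seteqP; split => // y; rewrite /xsection/= inE => -[] /=.
  by rewrite notin_setE in xA.
rewrite mul1e -[RHS](haar_mulr (S (- s) x^-1%g)); last exact: mS.
congr (mu _).
have E y : N (1^-1 * S s (y * S (- s) x^-1))%g = N (1^-1 * (x * (S s y)^-1))%g.
  by rewrite (flow_morph fl) (flowKN fl) invg1 !mul1g
    -(flow_normV fl) invgM invgK.
rewrite inE in xA.
apply/seteqP; split => y; rewrite /xsection/= inE /W2 /B /qball /rho /= E.
  by case.
by split.
Qed.

End haar_scaling.

Lemma ge0_integral_eq0_ae d (T : measurableType d) (R : realType)
    (mu : {measure set T -> \bar R}) (f : T -> \bar R) :
  measurable_fun [set: T] f -> (forall x, 0 <= f x)%E ->
  (\int[mu]_x f x = 0)%E -> {ae mu, forall x, f x = 0%E}.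
Proof.
move=> mf f0 If; have : (\int[mu]_x `|f x| = 0)%E.
  by rewrite -If; apply: eq_integral => x _; rewrite gee0_abs.
by move=> /(ae_eq_integral_abs mu measurableT mf); apply: filterS => x; apply.
Qed.

Section haar_scaling_complete.
Local Open Scope ereal_scope.
Context {R : realType} {d : measure_display} {G : measTopGroupType d}.
Variables (S : R -> G -> G) (N : G -> R) (Q : R).
Variable mu : {sigma_finite_measure set G -> \bar R}.
Hypothesis fl : dilation_flow S N.
Hypothesis hmu : haar_measure mu.
Hypothesis hQ : forall (x : G) (r : R), (0 < r)%R -> mu (qball N x r)
  = (r `^ Q)%:E.

Lemma haar_null_borel_cover (Z : set G) : mu.-negligible Z ->
  exists B, [/\ borel_set B, Z `<=` B & mu B = 0].
Proof.
move=> [A [mA A0 ZA]];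
  have [[_ [_ /(_ (~` A) (measurableC mA))[B [bB BA AB0]]]] _ _ _ _] := hmu.
have mB := borel_haar_measurable hmu bB.
exists (~` B); split.
- by rewrite -setTD; apply: sigma_algebraCD.
- by move=> x /ZA Ax Bx; exact: (BA x).
have -> : ~` B = (~` A `\` B) `|` A.
  apply/seteqP; split => x.
    by move=> nBx; have [Ax|nAx] := pselect (A x); [right|left].
  by case => [[]//|Ax Bx]; exact: (BA x).
have mAB : measurable (~` A `\` B) by apply: measurableD => //;
  exact: measurableC.
by rewrite measureU0.
Qed.

(** A measurable set is Borel up to a null set, and preimages of Borel null
    sets are null by scaling. *)
Lemma measurable_flow s : measurable_fun [set: G] (S s).
Proof.
move=> _ A mA; rewrite setTI.
have [[_ [cmu /(_ A mA)[B [bB BA AB0]]]] _ _ _ _] := hmu.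
have mB := borel_haar_measurable hmu bB.
have [Z [bZ ABZ Z0]] : exists B', [/\ borel_set B', A `\` B `<=`
  B' & mu B' = 0].
  by apply: haar_null_borel_cover; apply/negligibleP => //; exact: measurableD.
have mS C : borel_set C -> measurable (S s @^-1` C).
  apply: measurable_preimage_borel => U oU; apply: (open_haar_measurable hmu).
  by apply: open_comp => // y _; exact: (continuous_flow fl).
have -> : S s @^-1` A = S s @^-1` B `|` S s @^-1` (A `\` B).
  by rewrite -preimage_setU setDUK.
apply: measurableU; first exact: mS.
have SZ0 : mu (S s @^-1` Z) = 0.
  by rewrite (haar_scaling_borel fl hmu hQ)// Z0 mule0.
apply: cmu; exists (S s @^-1` Z); split => //; first exact: mS.
exact: preimage_subset.
Qed.

Lemma haar_scaling s (A : set G) : measurable A ->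
  mu (S s @^-1` A) = (expR (- s) `^ Q)%:E * mu A.
Proof.
move=> mA; have [[_ [cmu /(_ A mA)[B [bB BA AB0]]]] _ _ _ _] := hmu.
have mB := borel_haar_measurable hmu bB.
have mAB := measurableD mA mB.
have [Z [bZ ABZ Z0]] : exists B', [/\ borel_set B', A `\` B `<=`
  B' & mu B' = 0].
  by apply: haar_null_borel_cover; apply/negligibleP.
have mS C : measurable C -> measurable (S s @^-1` C).
  by move=> mC; rewrite -[X in measurable X]setTI; exact: measurable_flow.
have SAB0 : mu (S s @^-1` (A `\` B)) = 0.
  apply/eqP; rewrite -measure_le0.
  have <- : mu (S s @^-1` Z) = 0.
    by rewrite (haar_scaling_borel fl hmu hQ)// Z0 mule0.
  apply: le_measure; rewrite ?inE;
    [exact: mS|exact: (mS _ (borel_haar_measurable hmu bZ))|].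
  exact: preimage_subset.
have E : A = B `|` (A `\` B) by rewrite setDUK.
have muA : mu A = mu B by rewrite [in LHS]E (measureU0 mB mAB AB0).
rewrite muA E preimage_setU (measureU0 (mS _ mB) (mS _ mAB) SAB0).
exact: (haar_scaling_borel fl hmu hQ).
Qed.

Lemma ge0_integral_flow s (f : G -> \bar R) : measurable_fun [set: G] f ->
  (forall x, 0 <= f x) ->
  \int[mu]_x f (S s x) = (expR (- s) `^ Q)%:E * \int[mu]_x f x.
Proof.
move=> mf f0; have mS := measurable_flow s.
pose c : {nonneg R} := NngNum (powR_ge0 (expR (- s)) Q).
rewrite -[RHS](@ge0_integral_mscale _ _ R mu setT measurableT c f)//.
rewrite -(@ge0_integral_pushforward _ _ _ _ _ _ mS mu setT f)//.
by apply: eq_measure_integral => A mA _; rewrite /= /pushforward haar_scaling.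
Qed.

Lemma integrable_flow s (f : G -> \bar R) : mu.-integrable [set: G] f ->
  mu.-integrable [set: G] (f \o S s).
Proof.
move=> /integrableP[mf foo]; apply/integrableP; split.
  by apply: measurableT_comp => //; exact: measurable_flow.
have mabs : measurable_fun [set: G] (abse \o f) by exact: measurableT_comp.
have := ge0_integral_flow s mabs (fun=> abse_ge0 _).
move=> /= ->.
by rewrite lte_mul_pinfty// lee_fin powR_ge0.
Qed.

Lemma integral_flow s (f : G -> \bar R) : mu.-integrable [set: G] f ->
  \int[mu]_x f (S s x) = (expR (- s) `^ Q)%:E * \int[mu]_x f x.
Proof.
move=> intf; have mf := measurable_int _ intf.
rewrite integralE [in RHS]integralE.
under [X in X - _ = _]eq_integral do rewrite (funepos_comp f)/=.
under [X in _ - X = _]eq_integral do rewrite (funeneg_comp f)/=.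
rewrite (ge0_integral_flow s (f := f^\+))//; last exact: measurable_funepos.
rewrite (ge0_integral_flow s (f := f^\-))//; last exact: measurable_funeneg.
have fp := integrable_pos_fin_num measurableT intf.
by rewrite [RHS](@muleBr _ (expR (- s) `^ Q)%:E _ _ isT
  (fin_num_adde_defr _ fp)).
Qed.

Variable l : G -> R.
Hypothesis ml : measurable_fun [set: G] l.

Lemma measurable_flow_pair (B : set G) : borel_set B ->
  measurable [set z : G * G | B (S (l z.2) z.1)].
Proof.
apply: (measurable_preimage_borel (f := fun z : G * G => S (l z.2) z.1)) => U
  oU.
apply: (measurable_preimage_open (p := fun z : G * G => l z.2)
  (q := fun z => z.1)
  second_countable_real (flow_second_countable fl) (flow_cont fl)) => // V oV.
  rewrite -[X in measurable X]setTI.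
  apply: (measurableT_comp ml measurable_snd) => //; exact: open_measurable.
rewrite -[X in measurable X]setTI; apply: measurable_fst => //.
exact: (open_haar_measurable hmu).
Qed.

(** In the set of the pairs (x, u) with S (l u) x in Z all sections at fixed
    u are null. To use Fubini, Z is first enlarged to a Borel null set, as
    preimages of arbitrary measurable sets need not be measurable in the
    product. *)
Lemma ae_flow_null (Z : set G) : mu.-negligible Z ->
  {ae mu, forall x, {ae mu, forall u, ~ Z (S (l u) x)}}.
Proof.
move=> /haar_null_borel_cover[B [bB ZB B0]].
pose W := [set z : G * G | B (S (l z.2) z.1)].
have mW : measurable W := measurable_flow_pair bB.
have : \int[mu]_x mu (xsection W x) = 0.
  rewrite (ysection_integral_xsection mu mW).
  under eq_integral => u _.
    rewrite (_ : ysection W u = S (l u) @^-1` B); last first.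
      by apply/seteqP; split => x; rewrite /ysection/= inE.
    rewrite (haar_scaling_borel fl hmu hQ)// B0 mule0; over.
  by rewrite integral0.
have mphi : measurable_fun [set: G] (fun x => mu (xsection W x)).
  exact: measurable_fun_xsection.
move=> /(ge0_integral_eq0_ae mphi (fun=> measure_ge0 _ _)).
apply: filterS => x W0; exists (xsection W x); split => //.
  exact: measurable_xsection.
move=> u /= /contrapT /ZB Bu; rewrite /xsection/= inE; exact: Bu.
Qed.

End haar_scaling_complete.

(** * Complex-valued functions and their integrals *)

Notation normc := ComplexField.Normc.normc.

Section complex_values.
Context {R : realType}.
Implicit Types z w : R[i].

Lemma normc_ge0 z : 0 <= normc z.
Proof. by case: z => a b; exact: sqrtr_ge0. Qed.

Lemma Re_le_normc z : `|complex.Re z| <= normc z.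
Proof.
case: z => a b /=; rewrite -sqrtr_sqr ler_wsqrtr// lerDl; exact: sqr_ge0.
Qed.

Lemma Im_le_normc z : `|complex.Im z| <= normc z.
Proof.
case: z => a b /=; rewrite -sqrtr_sqr ler_wsqrtr// lerDr; exact: sqr_ge0.
Qed.

Lemma normc_le_ReIm z : normc z <= `|complex.Re z| + `|complex.Im z|.
Proof.
case: z => a b /=; rewrite -[leRHS]ger0_norm ?addr_ge0// -sqrtr_sqr.
apply: ler_wsqrtr; rewrite sqrrD !real_normK ?num_real// [leRHS]addrAC.
by rewrite lerDl mulrn_wge0// mulr_ge0.
Qed.

Lemma normc_sqr z : normc z ^+ 2 = complex.Re z ^+ 2 + complex.Im z ^+ 2.
Proof. by case: z => a b /=; rewrite sqr_sqrtr// addr_ge0// sqr_ge0. Qed.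

Lemma dot_le_normc z w :
  complex.Re z * complex.Re w + complex.Im z * complex.Im w <=
    normc z * normc w.
Proof.
apply: le_trans (ler_norm _) _.
rewrite -ler_sqr ?nnegrE ?normr_ge0 ?mulr_ge0 ?normc_ge0//.
rewrite real_normK ?num_real// exprMn !normc_sqr.
set a := complex.Re z; set b := complex.Im z; set c := complex.Re w;
  set e := complex.Im w.
rewrite -subr_ge0.
have -> : (a ^+ 2 + b ^+ 2) * (c ^+ 2 + e ^+ 2) - (a * c + b * e) ^+ 2 =
  (a * e - b * c) ^+ 2 by ring.
exact: sqr_ge0.
Qed.

Lemma ReD z w : complex.Re (z + w) = complex.Re z + complex.Re w.
Proof. by case: z; case: w. Qed.
Lemma ImD z w : complex.Im (z + w) = complex.Im z + complex.Im w.
Proof. by case: z; case: w. Qed.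
Lemma ReN z : complex.Re (- z) = - complex.Re z. Proof. by case: z. Qed.
Lemma ImN z : complex.Im (- z) = - complex.Im z. Proof. by case: z. Qed.
Lemma ReM z w : complex.Re (z * w) =
  complex.Re z * complex.Re w - complex.Im z * complex.Im w.
Proof. by case: z; case: w. Qed.
Lemma ImM z w : complex.Im (z * w) =
  complex.Re z * complex.Im w + complex.Im z * complex.Re w.
Proof. by case: z => a b; case: w. Qed.

Lemma ler_normcD z w : normc (z + w) <= normc z + normc w.
Proof.
rewrite -ler_sqr ?nnegrE ?addr_ge0 ?normc_ge0//.
rewrite sqrrD !normc_sqr ReD ImD; have := dot_le_normc z w; nra.
Qed.

Lemma eqC z w : complex.Re z = complex.Re w -> complex.Im z =
  complex.Im w -> z = w.
Proof. by case: z => a b; case: w => c e /= -> ->. Qed.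

Lemma normc0 : normc (0 : R[i]) = 0.
Proof. by rewrite /= expr0n /= addr0 sqrtr0. Qed.

Lemma normcM z w : normc (z * w) = normc z * normc w.
Proof. exact: ComplexField.Normc.normcM. Qed.

Variable K : set R[i].
Hypothesis hK : real_or_complex K.

Lemma scalar0 : K 0. Proof. by case: hK => ->. Qed.

Lemma scalarM z w : K z -> K w -> K (z * w).
Proof. by case: hK => -> //= z0 w0; rewrite ImM z0 w0 mulr0 mul0r addr0. Qed.

Lemma scalar_real (r : R) : K (Complex r 0).
Proof. by case: hK => ->. Qed.

End complex_values.

Section complex_integral.
Context {R : realType} {d : measure_display} {G : measTopGroupType d}.
Variable mu : {measure set G -> \bar R}.
Implicit Types f g : G -> R[i].

Lemma measurable_normc d' (T : measurableType d') (f : T -> R[i]) :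
  measurable_fun [set: T] (fun x => complex.Re (f x)) ->
  measurable_fun [set: T] (fun x => complex.Im (f x)) ->
  measurable_fun [set: T] (fun x => normc (f x)).
Proof.
move=> m1 m2.
have -> : (fun x => normc (f x)) =
    (fun x => Num.sqrt (complex.Re (f x) ^+ 2 + complex.Im (f x) ^+ 2)).
  by apply/funext => x; case: (f x).
apply: (measurableT_comp (f := fun y : R => Num.sqrt y)).
  exact: (continuous_measurable_fun (@sqrt_continuous R)).
by apply: measurable_funD; apply: measurable_funX.
Qed.

Lemma cmeasurable_normc f : cmeasurable f ->
  measurable_fun [set: G] (fun x => normc (f x)).
Proof. by case; exact: measurable_normc. Qed.

Lemma cmeasurable_mul f g : cmeasurable f -> cmeasurable g ->
  cmeasurable (fun x => f x * g x).
Proof.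
move=> [f1 f2] [g1 g2]; split.
  rewrite (_ : (fun x => _) = (fun x => complex.Re (f x) * complex.Re (g x) -
    complex.Im (f x) * complex.Im (g x)));
      last by apply/funext => x; rewrite ReM.
  by apply: measurable_funB; apply: measurable_funM.
rewrite (_ : (fun x => _) = (fun x => complex.Re (f x) * complex.Im (g x) +
  complex.Im (f x) * complex.Re (g x))); last by apply/funext => x; rewrite ImM.
by apply: measurable_funD; apply: measurable_funM.
Qed.

Lemma cintegrable_Re f : cintegrable mu [set: G] f ->
  mu.-integrable [set: G] (EFin \o (fun x => complex.Re (f x))).
Proof.
move=> [mf foo]; apply/integrableP; split;
  first by apply/measurable_EFinP; case: mf.
apply: le_lt_trans foo; apply: ge0_le_integral => //.
- by apply: measurableT_comp => //; apply/measurable_EFinP; case: mf.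
- exact/measurable_EFinP/cmeasurable_normc.
- by move=> x _; rewrite /= lee_fin Re_le_normc.
Qed.

Lemma cintegrable_Im f : cintegrable mu [set: G] f ->
  mu.-integrable [set: G] (EFin \o (fun x => complex.Im (f x))).
Proof.
move=> [mf foo]; apply/integrableP; split;
  first by apply/measurable_EFinP; case: mf.
apply: le_lt_trans foo; apply: ge0_le_integral => //.
- by apply: measurableT_comp => //; apply/measurable_EFinP; case: mf.
- exact/measurable_EFinP/cmeasurable_normc.
- by move=> x _; rewrite /= lee_fin Im_le_normc.
Qed.

Lemma cintegrable_normc f : cintegrable mu [set: G] f ->
  mu.-integrable [set: G] (EFin \o (fun x => normc (f x))).
Proof.
move=> [mf foo]; apply/integrableP; split.
  exact/measurable_EFinP/cmeasurable_normc.
by under eq_integral do rewrite /= ger0_norm ?normc_ge0//.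
Qed.

Lemma Rintegral_ae_eq (f g : G -> R) :
  measurable_fun [set: G] f -> measurable_fun [set: G] g ->
  {ae mu, forall x, f x = g x} -> (\int[mu]_x f x = \int[mu]_x g x)%R.
Proof.
move=> mf mg fg; rewrite /Rintegral; congr fine; apply: ae_eq_integral => //.
- exact/measurable_EFinP.
- exact/measurable_EFinP.
- by apply: filterS fg => x /= -> _.
Qed.

Lemma cintegral_ae_eq (f g : G -> R[i]) : cmeasurable f -> cmeasurable g ->
  {ae mu, forall x, f x = g x} -> cintegral mu f = cintegral mu g.
Proof.
move=> [mf1 mf2] [mg1 mg2] fg; rewrite /cintegral; congr Complex.
  by apply: Rintegral_ae_eq => //; apply: filterS fg => x /= ->.
by apply: Rintegral_ae_eq => //; apply: filterS fg => x /= ->.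
Qed.

(** With z the integral of f, |z|^2 = int <z, f> <= |z| int |f|. *)
Lemma le_cintegral f : cintegrable mu [set: G] f ->
  normc (cintegral mu f) <= \int[mu]_x normc (f x).
Proof.
move=> If; have I1 := cintegrable_Re If; have I2 := cintegrable_Im If.
have I3 := cintegrable_normc If.
set z := cintegral mu f.
have [z0|z0] := eqVneq (normc z) 0.
  by rewrite z0; apply: Rintegral_ge0 => x _; exact: normc_ge0.
have z_gt0 : 0 < normc z by rewrite lt_def z0 normc_ge0.
rewrite -(ler_pM2l z_gt0) -expr2 normc_sqr !expr2
  -[leRHS](RintegralZl (normc z) measurableT I3).
change (complex.Re z * (\int[mu]_x complex.Re (f x)) +
  complex.Im z * (\int[mu]_x complex.Im (f x)) <=
    \int[mu]_x (normc z * normc (f x))).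
rewrite -(RintegralZl (complex.Re z) measurableT I1)
  -(RintegralZl (complex.Im z) measurableT I2).
rewrite -RintegralD//; last 2 first.
- exact: (integrableZl measurableT (complex.Re z) I1).
- exact: (integrableZl measurableT (complex.Im z) I2).
apply: le_Rintegral => //.
- apply: (integrableD measurableT
    (f := EFin \o (fun x => complex.Re z * complex.Re (f x)))
    (g := EFin \o (fun x => complex.Im z * complex.Im (f x)))).
  + exact: (integrableZl measurableT (complex.Re z) I1).
  + exact: (integrableZl measurableT (complex.Im z) I2).
- exact: (integrableZl measurableT (normc z) I3).
- by move=> x _; exact: dot_le_normc.
Qed.

Lemma cintegral_linear k f g : cintegrable mu [set: G] f -> cintegrable mu
  [set: G] g ->
  cintegral mu (fun x => k * f x + g x) = k * cintegral mu f + cintegral mu g.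
Proof.
move=> If Ig.
have f1 := cintegrable_Re If; have f2 := cintegrable_Im If.
have g1 := cintegrable_Re Ig; have g2 := cintegrable_Im Ig.
have Z c := integrableZl measurableT c f1.
have Z' c := integrableZl measurableT c f2.
apply: eqC; rewrite /cintegral ?ReD ?ImD ?ReM ?ImM /=.
  under eq_Rintegral do rewrite ReD ReM.
  rewrite RintegralD//; last exact: (integrableB measurableT (Z _) (Z' _)).
  by rewrite RintegralB ?RintegralZl//; [exact: Z|exact: Z'].
under eq_Rintegral do rewrite ImD ImM.
rewrite RintegralD//; last exact: (integrableD measurableT (Z' _) (Z _)).
by rewrite RintegralD ?RintegralZl//; [exact: Z'|exact: Z].
Qed.

Lemma cintegrable0 : cintegrable mu [set: G] (fun=> 0 : R[i]).
Proof.
split; first by split; exact: measurable_cst.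
by rewrite normc0 integral0 ltry.
Qed.

Lemma cintegral0 : cintegral mu (fun=> 0 : R[i]) = 0.
Proof. by apply: eqC; rewrite /cintegral /= /Rintegral integral0. Qed.

Lemma cintegrable_linear k f g : cintegrable mu [set: G] f -> cintegrable mu
  [set: G] g ->
  cintegrable mu [set: G] (fun x => k * f x + g x).
Proof.
move=> If Ig; have [[mf1 mf2] _] := If; have [[mg1 mg2] _] := Ig.
have mkf : cmeasurable (fun x => k * f x).
  by apply: cmeasurable_mul => //; split; exact: measurable_cst.
have mkfg : cmeasurable (fun x => k * f x + g x).
  case: mkf => m1 m2; split.
    by under eq_fun do rewrite ReD; exact: measurable_funD.
  by under eq_fun do rewrite ImD; exact: measurable_funD.
split => //.
have Inf := integrableZl measurableT (normc k) (cintegrable_normc If).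
have := integrableD measurableT Inf (cintegrable_normc Ig).
move=> /integrableP[_]; apply: le_lt_trans; apply: ge0_le_integral => //.
- by move=> x _; rewrite lee_fin normc_ge0.
- exact/measurable_EFinP/cmeasurable_normc.
- apply: measurableT_comp => //; apply: emeasurable_funD.
    by apply: measurable_funeM; exact/measurable_EFinP/cmeasurable_normc.
  exact/measurable_EFinP/cmeasurable_normc.
move=> x _ /=; rewrite ger0_norm ?addr_ge0 ?mulr_ge0 ?normc_ge0//
  -normcM lee_fin.
exact: ler_normcD.
Qed.

Lemma cintegrable_scale k f : cintegrable mu [set: G] f ->
  cintegrable mu [set: G] (fun x => k * f x).
Proof.
move=> If; have := cintegrable_linear k If cintegrable0.
by congr (cintegrable _ _ _); apply/funext => x; rewrite addr0.
Qed.

Lemma cintegral_scale k f : cintegrable mu [set: G] f ->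
  cintegral mu (fun x => k * f x) = k * cintegral mu f.
Proof.
move=> If; have := cintegral_linear k If cintegrable0.
rewrite cintegral0 addr0 => <-.
by congr cintegral; apply/funext => x; rewrite addr0.
Qed.

Lemma cintegral_sum (F : nat -> G -> R[i]) :
  (forall n, cintegrable mu [set: G] (F n)) -> forall m : nat,
  cintegrable mu [set: G] (fun x => \sum_(n < m) F n x) /\
  cintegral mu (fun x => \sum_(n < m) F n x) = \sum_(n < m) cintegral mu (F n).
Proof.
move=> IF; elim=> [|m [IH1 IH2]].
  split; first by under eq_fun do rewrite big_ord0; exact: cintegrable0.
  by under eq_fun do rewrite big_ord0; rewrite big_ord0 cintegral0.
have E : (fun x => \sum_(n < m.+1) F n x) =
  (fun x => 1 * F m x + \sum_(n < m) F n x).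
  by apply/funext => x; rewrite big_ord_recr /= mul1r addrC.
split; first by rewrite E; exact: cintegrable_linear.
by rewrite E cintegral_linear// mul1r IH2 big_ord_recr /= addrC.
Qed.

Lemma cintegral_scalar (K : set R[i]) f : real_or_complex K ->
  (forall x, K (f x)) -> K (cintegral mu f).
Proof.
case=> KE; rewrite KE // => f0 /=.
by rewrite /Rintegral; under eq_integral do rewrite f0; rewrite integral0.
Qed.

End complex_integral.

(** * Borel representatives of functions and atoms *)

Lemma bigcup_pickle (T : Type) (I : countType) (F : I -> set T) :
  \bigcup_i F i = \bigcup_n oapp F set0 (unpickle n).
Proof.
apply/seteqP; split => [x [q _ Fx]|x [n _]].
  by exists (pickle q); [by []|rewrite pickleK].
by case: unpickle => //= q Fx; exists q.
Qed.

Section borel_sets.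
Context {G : topologicalType}.
Implicit Types A B : set G.

Let sa : sigma_algebra [set: G] borel_set := smallest_sigma_algebra setT _.

Lemma borel_set0 : borel_set (@set0 G). Proof. by case: sa. Qed.

Lemma borel_setC A : borel_set A -> borel_set (~` A).
Proof. by rewrite -setTD; case: sa => _ + _; apply. Qed.

Lemma borel_bigcup (F : nat -> set G) :
  (forall i, borel_set (F i)) -> borel_set (\bigcup_i F i).
Proof. by case: sa => _ _; apply. Qed.

Lemma borel_setU A B : borel_set A -> borel_set B -> borel_set (A `|` B).
Proof.
move=> bA bB; rewrite -bigcup2E; apply: borel_bigcup => -[|[|n]] //=.
exact: borel_set0.
Qed.

Lemma borel_setD A B : borel_set A -> borel_set B -> borel_set (A `\` B).
Proof.
move=> bA bB; rewrite -[_ `\` _]setCK; apply: borel_setC.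
by rewrite setCD; apply: borel_setU => //; exact: borel_setC.
Qed.

Lemma borel_bigcup_rat (F : rat -> set G) :
  (forall i, borel_set (F i)) -> borel_set (\bigcup_i F i).
Proof.
move=> bF.
rewrite bigcup_pickle; apply: borel_bigcup => n.
by case: unpickle => [q|] /=; [exact: bF|exact: borel_set0].
Qed.

Definition borel_fun {R : realType} (f : G -> R) : Prop :=
  forall Y, measurable Y -> borel_set (f @^-1` Y).

Lemma borel_fun_rays {R : realType} (f : G -> R) :
  (forall q : rat, borel_set [set x | ratr q < f x]) -> borel_fun f.
Proof.
move=> fq Y mY.
have {mY} : <<s @RGenOInfty.G R >> Y.
  have <- : measurable = <<s @RGenOInfty.G R >> :> set (set R) by
    exact: RGenOInfty.measurableE.
  exact: mY.
move: Y; apply: smallest_sub.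
  split => [|A bA|F bF] /=.
  - by rewrite preimage_set0; exact: borel_set0.
  - by rewrite setTD preimage_setC; exact: borel_setC.
  - by rewrite preimage_bigcup => //; apply: borel_bigcup => i; exact: bF.
move=> _ [y ->] /=.
have -> : f @^-1` `]y,
  +oo[%classic = \bigcup_q
  (if y <= ratr q then [set x | ratr q < f x] else set0).
  apply/seteqP; split => [x /=|x [q _]].
    rewrite in_itv/= andbT => yfx.
    have [q] := rat_in_itvoo yfx; rewrite in_itv/= => /andP[yq qf].
    by exists q => //; rewrite (ltW yq).
  by case: ifPn => //= yq qf; rewrite in_itv/= andbT (le_lt_trans yq).
apply: borel_bigcup_rat => q; case: ifPn => // _; exact: borel_set0.
Qed.

End borel_sets.

Section borel_modification.
Context {R : realType} {d : measure_display} {G : measTopGroupType d}.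
Variable mu : {sigma_finite_measure set G -> \bar R}.
Hypothesis hmu : haar_measure mu.

Lemma borel_fun_measurable (f : G -> R) : borel_fun f ->
  measurable_fun [set: G] f.
Proof.
by move=> bf _ Y mY; rewrite setTI;
  apply: (borel_haar_measurable hmu); exact: bf.
Qed.

(** The sets where f exceeds a rational are Borel up to null sets, whose
    union is Z. The conclusion holds for every larger Borel set, so that
    several functions can be modified on one and the same set. *)
Lemma borel_modification (f : G -> R) : measurable_fun [set: G] f ->
  exists Z, mu.-negligible Z /\ forall Z', borel_set Z' -> Z `<=` Z' ->
    borel_fun (fun x => if x \in Z' then 0 else f x).
Proof.
move=> mf.
have /choice[B hB] : forall q : rat, exists B : set G,
  [/\ borel_set B, B `<=` [set x | ratr q < f x] &
   mu.-negligible ([set x | ratr q < f x] `\` B)].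
  move=> q; have mA : measurable [set x | ratr q < f x].
    have := mf measurableT `]ratr q, +oo[%classic (measurable_itv _).
    by rewrite setTI; congr measurable; apply/seteqP; split => x /=;
      rewrite in_itv/= andbT.
  have [[_ [_ /(_ _ mA)[B [bB BA AB0]]]] _ _ _ _] := hmu.
  exists B; split => //; apply/negligibleP => //.
  by apply: measurableD => //; exact: (borel_haar_measurable hmu).
exists (\bigcup_q ([set x | ratr q < f x] `\` B q)); split.
  rewrite bigcup_pickle.
  apply: negligible_bigcup => n; case: unpickle => [q|] /=;
    last exact: negligible_set0.
  by have [] := hB q.
move=> Z' bZ' ZZ'; apply: borel_fun_rays => q.
have [bB BA _] := hB q.
have -> : [set x | ratr q < (if x \in Z' then 0 else f x)] =
    (B q `\` Z') `|` (if ratr q < 0 :> R then Z' else set0).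
  apply/seteqP; split => x /=.
    have [|] := boolP (x \in Z'); rewrite ?inE ?notin_setE => xZ'.
      by move=> ->; right.
    move=> qf; left; split => //; apply: contrapT => nB; apply: xZ'.
    by apply: ZZ'; exists q.
  case=> [[Bx nZ]|]; first by rewrite memNset//; exact: BA.
  by case: ifPn => // q0 xZ; rewrite mem_set.
apply: borel_setU; first exact: borel_setD.
by case: ifPn => // _; exact: borel_set0.
Qed.

End borel_modification.

Section atoms.
Context {R : realType} {d : measure_display} {G : measTopGroupType d}.
Variable mu : {sigma_finite_measure set G -> \bar R}.

(** Atoms that are Borel, which makes (x, u) |-> a (S (l u) x) measurable on
    the product, and bounded everywhere, which makes its sections integrable
    for every x. The bound is the inverse of the measure of the ball. *)
Record borel_atom (N : G -> R) (Q : R) (K : set R[i]) (x0 : G) (r : R)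
    (a : G -> R[i]) : Prop := BorelAtom {
  borel_atom_scalar : forall x, K (a x);
  borel_atom_Re : borel_fun (fun x => complex.Re (a x));
  borel_atom_Im : borel_fun (fun x => complex.Im (a x));
  borel_atom_radius : 0 < r;
  borel_atom_support : forall y, a y != 0 -> qball N x0 r y;
  borel_atom_bound : forall y, normc (a y) <= (r `^ Q)^-1;
  borel_atom_mean : cintegral mu a = 0 }.

Variables (S : R -> G -> G) (N : G -> R) (Q : R) (K : set R[i]).
Hypothesis fl : dilation_flow S N.
Hypothesis hmu : haar_measure mu.
Hypothesis hQ : forall (x : G) (r : R), 0 < r -> mu (qball N x r) = (r `^ Q)%:E.
Hypothesis hK : real_or_complex K.

(** The atom is set to 0 on a Borel null set containing the points where it
    exceeds its bound; this cannot enlarge its support. *)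
Lemma atom_borel_version (a : G -> R[i]) : atom mu N K a ->
  exists x0 r a', borel_atom N Q K x0 r a' /\ {ae mu, forall x, a x = a' x}.
Proof.
case=> aK [ma1 ma2] [x0 [r [r0 asupp /ess_supP asup aint]]].
have [Z1 [Z10 hZ1]] := borel_modification hmu ma1.
have [Z2 [Z20 hZ2]] := borel_modification hmu ma2.
rewrite [X in fine X](hQ x0 r0) /= in asup.
have := negligibleU (negligibleU Z10 Z20) asup.
move=> /(haar_null_borel_cover hmu)[Z [bZ ZZ Z0]].
pose a' x := if x \in Z then 0 else a x.
have E1 : (fun x => complex.Re (a' x)) =
  (fun x => if x \in Z then 0 else complex.Re (a x)).
  by apply/funext => x; rewrite /a'; case: ifPn.
have E2 : (fun x => complex.Im (a' x)) =
  (fun x => if x \in Z then 0 else complex.Im (a x)).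
  by apply/funext => x; rewrite /a'; case: ifPn.
have b1 : borel_fun (fun x => complex.Re (a' x)).
  by rewrite E1; apply: hZ1 => // x Zx; apply: ZZ; left; left.
have b2 : borel_fun (fun x => complex.Im (a' x)).
  by rewrite E2; apply: hZ2 => // x Zx; apply: ZZ; left; right.
have aa' : {ae mu, forall x, a x = a' x}.
  exists Z; split => //; first exact: (borel_haar_measurable hmu).
  move=> x /= naa'; apply: contrapT => nZ; apply: naa'.
  by rewrite /a' memNset.
exists x0, r, a'; split => //; split => //.
- by move=> x; rewrite /a'; case: ifPn => // _; exact: scalar0.
- by move=> y; rewrite /a'; case: ifPn => [_|_ /asupp//]; rewrite eqxx.
- move=> y; rewrite /a'; case: ifPn => [_|].
    by rewrite normc0 invr_ge0 powR_ge0.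
  rewrite notin_setE => nZ; apply: contrapT => nle; apply: nZ;
    apply: ZZ; right => /=.
  by rewrite lee_fin.
- rewrite -aint; apply: cintegral_ae_eq => //.
    by split; exact: (borel_fun_measurable hmu).
  by apply: filterS aa' => x ->.
Qed.

Lemma borel_atom_measurable x0 r a : borel_atom N Q K x0 r a -> cmeasurable a.
Proof. by case=> _ b1 b2 _ _ _ _; split; exact: (borel_fun_measurable hmu). Qed.

Lemma qball_L1_bound (f : G -> R[i]) x0 r c : cmeasurable f ->
  0 < r -> 0 <= c ->
  (forall y, f y != 0 -> qball N x0 r y) -> (forall y, normc (f y) <= c) ->
  (\int[mu]_x (normc (f x))%:E <= (c * r `^ Q)%:E)%E.
Proof.
move=> [m1 m2] r0 c0 fsupp fc.
have mB : measurable (qball N x0 r) by apply: (open_haar_measurable hmu);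
  exact: (open_qball fl).
apply: (@le_trans _ _ (\int[mu]_x (c%:E * (\1_(qball N x0 r) x)%:E))%E).
  apply: ge0_le_integral => //.
  - by move=> x _; rewrite lee_fin normc_ge0.
  - by apply/measurable_EFinP; exact: measurable_normc.
  - by apply: measurable_funeM; apply/measurable_EFinP.
  move=> x _; rewrite indicE -EFinM lee_fin.
  have [xB|xB] := boolP (x \in _); first by rewrite mulr1.
  rewrite mulr0; have [->|/fsupp xB'] := eqVneq (f x) 0;
    first by rewrite normc0.
  by rewrite notin_setE in xB.
rewrite ge0_integralZl//; last exact/measurable_EFinP.
by rewrite integral_indic// setIT [X in (_ * X)%E](hQ x0 r0) -EFinM.
Qed.

Lemma borel_atom_L1 x0 r a : borel_atom N Q K x0 r a ->
  (\int[mu]_x (normc (a x))%:E <= 1)%E.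
Proof.
move=> ba; have ma := borel_atom_measurable ba; case: ba => _ _ _ r0 asupp ab _.
have rQ : 0 < r `^ Q by rewrite powR_gt0.
apply: le_trans (qball_L1_bound ma r0 _ asupp ab) _;
  first by rewrite invr_ge0 ltW.
by rewrite mulVf// gt_eqF.
Qed.

End atoms.

(** * The Hausdorff kernel on the product space *)

Section flow_kernel.
Context {R : realType} {d : measure_display} {G : measTopGroupType d}.
Variables (S : R -> G -> G) (N : G -> R) (Q : R).
Variable mu : {sigma_finite_measure set G -> \bar R}.
Hypothesis fl : dilation_flow S N.
Hypothesis hmu : haar_measure mu.
Hypothesis hQ : forall (x : G) (r : R), 0 < r -> mu (qball N x r) = (r `^ Q)%:E.
Variable l : G -> R.
Hypothesis ml : measurable_fun [set: G] l.

Definition flow_kernel (Psi a : G -> R[i]) (x u : G) : R[i] := Psi u *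
  a (S (l u) x).

Lemma measurable_borel_flow (h : G -> R) : borel_fun h ->
  measurable_fun [set: G * G] (fun z => h (S (l z.2) z.1)).
Proof.
move=> bh _ Y mY; rewrite setTI.
exact: (measurable_flow_pair fl hmu ml (bh Y mY)).
Qed.

Definition flow_weight (Psi : G -> R[i]) : \bar R :=
  (\int[mu]_u (normc (Psi u) * expR (- l u) `^ Q)%:E)%E.

Lemma flow_weight_ge0 Psi : (0 <= flow_weight Psi)%E.
Proof.
by apply: integral_ge0 => u _; rewrite lee_fin mulr_ge0 ?normc_ge0 ?powR_ge0.
Qed.

Lemma measurable_flow_weight Psi : cmeasurable Psi ->
  measurable_fun [set: G] (fun u => (normc (Psi u) * expR (- l u) `^ Q)%:E).
Proof.
move=> mPsi; apply/measurable_EFinP.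
apply: measurable_funM; first exact: cmeasurable_normc.
apply: (measurableT_comp (f := fun y : R => y `^ Q));
  first exact: measurable_powR.
by apply: measurableT_comp => //; exact: measurableT_comp.
Qed.

Variables (Psi a : G -> R[i]).
Hypothesis mPsi : cmeasurable Psi.
Hypothesis aRe : borel_fun (fun x => complex.Re (a x)).
Hypothesis aIm : borel_fun (fun x => complex.Im (a x)).

Let ma : cmeasurable a.
Proof. by split; exact: (borel_fun_measurable hmu). Qed.

Lemma flow_kernel_measurable_Re :
  measurable_fun [set: G * G] (fun z => complex.Re (flow_kernel Psi a z.1 z.2)).
Proof.
rewrite (_ : (fun z => _) = (fun z => complex.Re (Psi z.2) * complex.Re
  (a (S (l z.2) z.1)) -
  complex.Im (Psi z.2) * complex.Im (a (S (l z.2) z.1))));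
    last by apply/funext => z; rewrite ReM.
case: mPsi => m1 m2.
apply: measurable_funB; apply: measurable_funM.
- exact: (measurableT_comp m1 measurable_snd).
- exact: (measurable_borel_flow aRe).
- exact: (measurableT_comp m2 measurable_snd).
- exact: (measurable_borel_flow aIm).
Qed.

Lemma flow_kernel_measurable_Im :
  measurable_fun [set: G * G] (fun z => complex.Im (flow_kernel Psi a z.1 z.2)).
Proof.
rewrite (_ : (fun z => _) = (fun z => complex.Re (Psi z.2) * complex.Im
  (a (S (l z.2) z.1)) +
  complex.Im (Psi z.2) * complex.Re (a (S (l z.2) z.1))));
    last by apply/funext => z; rewrite ImM.
case: mPsi => m1 m2.
apply: measurable_funD; apply: measurable_funM.
- exact: (measurableT_comp m1 measurable_snd).
- exact: (measurable_borel_flow aIm).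
- exact: (measurableT_comp m2 measurable_snd).
- exact: (measurable_borel_flow aRe).
Qed.

Lemma flow_kernel_measurable x : cmeasurable (flow_kernel Psi a x).
Proof.
split.
  exact: (measurableT_comp flow_kernel_measurable_Re (measurable_pair1 x)).
exact: (measurableT_comp flow_kernel_measurable_Im (measurable_pair1 x)).
Qed.

Lemma flow_kernel_measurable_normc :
  measurable_fun [set: G * G] (fun z => normc (flow_kernel Psi a z.1 z.2)).
Proof.
exact: (measurable_normc flow_kernel_measurable_Re flow_kernel_measurable_Im).
Qed.

(** Dilating by S s multiplies the L^1 norm by exp(- s Q), so in L^1 the
    operator is bounded by the weighted norm of its kernel. *)
Lemma integral_flow_kernel_normc :
  (\int[mu]_x \int[mu]_u (normc (flow_kernel Psi a x u))%:E =
   flow_weight Psi * \int[mu]_x (normc (a x))%:E)%E.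
Proof.
have mf := flow_kernel_measurable_normc.
rewrite (fubini_tonelli (fun z => (normc (flow_kernel Psi a z.1 z.2))%:E));
  last 2 first.
- exact/measurable_EFinP.
- by move=> z; rewrite lee_fin normc_ge0.
have ma0 : (0 <= \int[mu]_x (normc (a x))%:E)%E.
  by apply: integral_ge0 => x _; rewrite lee_fin normc_ge0.
have mna : measurable_fun [set: G] (fun x => (normc (a x))%:E).
  exact/measurable_EFinP/cmeasurable_normc.
rewrite /flow_weight -ge0_integralZr//; last 2 first.
- exact: measurable_flow_weight.
- by move=> u _; rewrite lee_fin mulr_ge0 ?normc_ge0 ?powR_ge0.
apply: eq_integral => u _ /=.
under eq_integral do rewrite /flow_kernel normcM EFinM.
rewrite ge0_integralZl//; last 3 first.
- exact: (measurableT_comp mna (measurable_flow fl hmu hQ _)).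
- by move=> x _; rewrite lee_fin normc_ge0.
- by rewrite lee_fin normc_ge0.
rewrite (ge0_integral_flow fl hmu hQ (l u) (f := fun x => (normc (a x))%:E))//.
  by rewrite EFinM muleA.
by move=> x; rewrite lee_fin normc_ge0.
Qed.

End flow_kernel.

(** * Pieces of the Hausdorff operator that are multiples of atoms *)

Section pieces.
Context {R : realType} {d : measure_display} {G : measTopGroupType d}.
Variables (S : R -> G -> G) (N : G -> R) (Q : R).
Variable mu : {sigma_finite_measure set G -> \bar R}.
Hypothesis fl : dilation_flow S N.
Hypothesis hmu : haar_measure mu.
Hypothesis hQ : forall (x : G) (r : R), 0 < r -> mu (qball N x r) = (r `^ Q)%:E.
Variable K : set R[i].
Hypothesis hK : real_or_complex K.

(** The intervals of times that can be treated at once for an atom carried by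
    the ball of radius r around x0. *)
Definition flow_tube (x0 : G) (r delta : R) : Prop :=
  forall s y, 0 <= s <= delta -> qball N x0 r y -> qball N x0 (2 * r) (S s y).

(** At s = 0 the inequality N (x0^-1 * S s y) < 2 r holds on the closed ball
    of radius r, which is compact; hence it persists for small s. *)
Lemma flow_tube_exists (x0 : G) (r : R) : 0 < r ->
  exists2 delta : R, 0 < delta & flow_tube x0 r delta.
Proof.
move=> r0; pose C := [set y | N (x0^-1 * y)%g <= r].
have cC : compact C.
  have := continuous_compact (continuous_subspaceT
    (@continuous_mull G (@flow_mul_cont _ _ _ _ fl) x0))
    (@flow_compact_ball _ _ _ _ fl r).
  congr compact; apply/seteqP; split => [_ [z Nz <-]|y Cy] /=.
    by rewrite /C/= mulKg.
  by exists (x0^-1 * y)%g => //; rewrite mulVKg.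
have /compact_near_coveringP cov := cC.
have phic : continuous (fun z : R * G => N (x0^-1 * S z.1 z.2)%g).
  move=> z.
  have h : (x0^-1 * S w.1 w.2)%g @[w --> z] --> (x0^-1 * S z.1 z.2)%g.
    exact: (@mulg_cvg G (@flow_mul_cont _ _ _ _ fl) _ (nbhs z) _
      (fun=> x0^-1%g) (fun w => S w.1 w.2) x0^-1%g (S z.1 z.2) (cvg_cst _)
      (@flow_cont _ _ _ _ fl z)).
  exact: (cvg_comp _ N h (@flow_norm_cont _ _ _ _ fl _)).
have : \forall s \near (0 : R), C `<=` [set y | N (x0^-1 * S s y)%g < 2 * r].
  apply: (cov R (nbhs (0 : R)) (fun s y => N (x0^-1 * S s y)%g < 2 * r)
    (nbhs_filter (0 : R))) => y Cy.
  have N2 : N (x0^-1 * S 0 y)%g < 2 * r.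
    by rewrite (flow_id fl) (le_lt_trans Cy)// ltr_pMl// ltr1n.
  have [[A B] /= [A0 By] AB] := @phic (0, y) _ (lt_nbhsl N2).
  exists (B, A) => //= -[y' s] [/= By' As]; exact: (AB (s, y')).
move=> /nbhs_ballP[e /= e0 he]; exists (e / 2); first by rewrite divr_gt0.
move=> s y /andP[s0 se] By; apply: (he s) => /=; last exact: ltW.
rewrite /ball/= sub0r normrN ger0_norm// (le_lt_trans se)//.
by rewrite ltr_pdivrMr// ltr_pMr// ltr1n.
Qed.

Variable l : G -> R.
Hypothesis ml : measurable_fun [set: G] l.

Variables (Psi a : G -> R[i]) (x0 : G) (r s delta : R).
Hypothesis mPsi : cmeasurable Psi.
Hypothesis PsiK : forall u, K (Psi u).
Hypothesis wPsi : (flow_weight Q mu l Psi < +oo)%E.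
Hypothesis Psi_supp : forall u, Psi u != 0 -> s - delta <= l u <= s.
Hypothesis tube : flow_tube x0 r delta.
Hypothesis ba : borel_atom mu N Q K x0 r a.

Let g (x : G) := cintegral mu (flow_kernel S l Psi a x).
Let kappa : R := 2 `^ Q * fine (flow_weight Q mu l Psi).
Let rho' := expR (- s) * (2 * r).

Let r_gt0 : 0 < r. Proof. exact: borel_atom_radius ba. Qed.

Let Psi_L1 : (\int[mu]_u (normc (Psi u))%:E <= (expR s `^ Q)%:E * flow_weight
  Q mu l Psi)%E.
Proof.
have h u : normc (Psi u) <= expR s `^ Q * (normc (Psi u) * expR (- l u) `^ Q).
  have [->|/Psi_supp/andP[_ lus]] := eqVneq (Psi u) 0;
    first by rewrite normc0 mul0r mulr0.
  rewrite mulrCA ler_peMr ?normc_ge0// -!expRM -expRD -[leLHS]expR0 ler_expR.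
  by rewrite -mulrDl mulr_ge0 ?(haar_dim_ge0 fl hmu hQ)// subr_ge0.
have mw := measurable_flow_weight Q ml mPsi.
rewrite /flow_weight -ge0_integralZl//; last by move=> u _;
  rewrite lee_fin mulr_ge0 ?normc_ge0 ?powR_ge0.
apply: ge0_le_integral => //.
- by move=> u _; rewrite lee_fin normc_ge0.
- exact/measurable_EFinP/cmeasurable_normc.
- exact: measurable_funeM.
- by move=> u _; rewrite -EFinM lee_fin.
Qed.

Let weight_ge0 := flow_weight_ge0 Q mu l Psi.

Let weight_fin : flow_weight Q mu l Psi \is a fin_num.
Proof. by rewrite ge0_fin_numE. Qed.

Let cPsi : cintegrable mu [set: G] Psi.
Proof.
split => //; apply: le_lt_trans Psi_L1 _.
by rewrite lte_mul_pinfty// lee_fin powR_ge0.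
Qed.

Let kernel_bound x u : normc (flow_kernel S l Psi a x u) <= (r `^ Q)^-1 *
  normc (Psi u).
Proof.
by rewrite /flow_kernel normcM mulrC ler_wpM2r ?normc_ge0//
  (borel_atom_bound ba).
Qed.

Let cker x : cintegrable mu [set: G] (flow_kernel S l Psi a x).
Proof.
have mk := flow_kernel_measurable fl hmu ml mPsi (borel_atom_Re ba)
  (borel_atom_Im ba) x.
split => //; apply: (@le_lt_trans _ _ (((r `^ Q)^-1)%:E * \int[mu]_u
  (normc (Psi u))%:E)%E).
  rewrite -ge0_integralZl//; last 3 first.
  - exact/measurable_EFinP/cmeasurable_normc.
  - by move=> u _; rewrite lee_fin normc_ge0.
  - by rewrite lee_fin invr_ge0 powR_ge0.
  apply: ge0_le_integral => //.
  - by move=> u _; rewrite lee_fin normc_ge0.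
  - exact/measurable_EFinP/cmeasurable_normc.
  - by apply: measurable_funeM; exact/measurable_EFinP/cmeasurable_normc.
  - by move=> u _; rewrite lee_fin.
by rewrite lte_mul_pinfty// ?lee_fin ?invr_ge0 ?powR_ge0//; case: cPsi.
Qed.

Let rho_gt0 : 0 < rho'. Proof. by rewrite mulr_gt0 ?expR_gt0 ?mulr_gt0. Qed.

Let kappa_ge0 : 0 <= kappa.
Proof. by rewrite mulr_ge0 ?powR_ge0 ?fine_ge0. Qed.

(** The ball of radius rho' has measure exp(- s Q) 2^Q r^Q, and the integral
    of |Psi| is at most exp(s Q) times its weighted integral. *)
Let piece_bound x : normc (g x) <= kappa * (rho' `^ Q)^-1.
Proof.
apply: le_trans (le_cintegral (cker x)) _.
apply: (@le_trans _ _ ((r `^ Q)^-1 * \int[mu]_u normc (Psi u))).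
  rewrite -RintegralZl//; last exact: (cintegrable_normc cPsi).
  apply: le_Rintegral => //; first exact: (cintegrable_normc (cker x)).
  exact: (integrableZl measurableT (r `^ Q)^-1 (cintegrable_normc cPsi)).
have h : \int[mu]_u normc (Psi u) <= expR s `^ Q *
  fine (flow_weight Q mu l Psi).
  rewrite -lee_fin EFinM !fineK//.
  by rewrite ge0_fin_numE; [case: cPsi|apply: integral_ge0 => u _;
    rewrite lee_fin normc_ge0].
apply: le_trans (ler_wpM2l _ h) _; first by rewrite invr_ge0 powR_ge0.
rewrite /kappa /rho' powRM ?expR_ge0 ?mulr_ge0 ?(ltW r_gt0)// powRM
  ?(ltW r_gt0)//.
rewrite -[expR (- s) `^ Q]expRM mulNr expRN expRM.
have e0 : expR s `^ Q != 0 by rewrite gt_eqF// powR_gt0 ?expR_gt0.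
have t0 : (2 : R) `^ Q != 0 by rewrite gt_eqF// powR_gt0.
have r0 : r `^ Q != 0 by rewrite gt_eqF// powR_gt0.
set W := fine _; suff -> : (r `^ Q)^-1 * (expR s `^ Q * W) =
  2 `^ Q * W * ((expR s `^ Q)^-1 * (2 `^ Q * r `^ Q))^-1 by [].
by field; rewrite e0 t0 r0.
Qed.

Let piece_support x : g x != 0 -> qball N (S (- s) x0) rho' x.
Proof.
move=> gx; rewrite -(flow_preimage_qball fl).
have [u ku] : exists u, flow_kernel S l Psi a x u != 0.
  apply: contrapT => /forallNP h; move/negP: gx; apply; apply/eqP.
  have -> : g x = cintegral mu (fun=> 0).
    by congr cintegral; apply/funext => u; apply/eqP; have := h u; move/negP;
      rewrite negbK.
  by apply: eqC; rewrite /cintegral /= /Rintegral integral0.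
have /andP[lu1 lu2] : s - delta <= l u <= s.
  by apply: Psi_supp; apply: contraNneq ku => P0; rewrite /flow_kernel P0 mul0r.
have Bu : qball N x0 r (S (l u) x).
  by apply: (borel_atom_support ba); apply: contraNneq ku => a0;
    rewrite /flow_kernel a0 mulr0.
have sE : S s x = S (s - l u) (S (l u) x) by rewrite -(flow_action fl) subrK.
by rewrite /= sE; apply: tube => //; rewrite subr_ge0 lu2/= lerBlDr
  addrC -lerBlDr.
Qed.

Let piece_scalar x : K (g x).
Proof.
apply: cintegral_scalar => // u.
by apply: scalarM => //; exact: borel_atom_scalar ba _.
Qed.

Let kernel_prod_integrable (F : G * G -> R) : measurable_fun [set: G * G] F ->
  (forall z, `|F z| <= normc (flow_kernel S l Psi a z.1 z.2)) ->
  (mu \x mu)%E.-integrable [set: G * G] (EFin \o F).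
Proof.
move=> mF Fle; apply/(integrable12ltyP mu mu); first exact/measurable_EFinP.
have mk := flow_kernel_measurable_normc fl hmu ml mPsi (borel_atom_Re ba)
  (borel_atom_Im ba).
have mk' : measurable_fun [set: G * G]
  (fun z => (normc (flow_kernel S l Psi a z.1 z.2))%:E).
  exact/measurable_EFinP.
apply: (@le_lt_trans _ _
  (\int[mu]_x \int[mu]_u (normc (flow_kernel S l Psi a x u))%:E)%E).
  apply: ge0_le_integral => //.
  - by move=> x _; apply: integral_ge0.
  - apply: (measurable_fun_fubini_tonelli_F (fun z => (`|F z|%:E))) => //.
    by apply/measurable_EFinP; exact: measurableT_comp.
  - apply: (measurable_fun_fubini_tonelli_F
      (fun z => (normc (flow_kernel S l Psi a z.1 z.2))%:E)) => //.
    by move=> z; rewrite lee_fin normc_ge0.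
  move=> x _; apply: ge0_le_integral => //.
  - by apply/measurable_EFinP; apply: measurableT_comp => //;
      exact: (measurableT_comp mF (measurable_pair1 x)).
  - exact: (measurableT_comp mk' (measurable_pair1 x)).
  - by move=> u _; rewrite lee_fin; exact: (Fle (x, u)).
rewrite (integral_flow_kernel_normc fl hmu hQ ml mPsi (borel_atom_Re ba)
  (borel_atom_Im ba)).
rewrite lte_mul_pinfty//.
by apply: le_lt_trans (borel_atom_L1 fl hmu hQ ba) _; rewrite ltry.
Qed.

Let ca : cintegrable mu [set: G] a.
Proof.
split; first exact: (borel_atom_measurable hmu ba).
by apply: le_lt_trans (borel_atom_L1 fl hmu hQ ba) _; rewrite ltry.
Qed.

Let mean_zero_flow (h : G -> R) k t : mu.-integrable [set: G] (EFin \o h) ->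
  \int[mu]_x h x = 0 -> (\int[mu]_x (k%:E * (h (S t x))%:E) = 0)%E.
Proof.
move=> Ih h0.
have Eh : (\int[mu]_x (EFin \o h) x = 0)%E.
  rewrite -[LHS]fineK; last exact: (integrable_fin_num measurableT Ih).
  by congr (_%:E); exact: h0.
apply: (etrans (integralZl measurableT (integrable_flow fl hmu hQ t Ih) k)).
by rewrite (integral_flow fl hmu hQ t Ih) Eh !mule0.
Qed.

Let Re_mean_flow k t :=
  mean_zero_flow k t (cintegrable_Re ca)
    (congr1 (@complex.Re R) (borel_atom_mean ba)).

Let Im_mean_flow k t :=
  mean_zero_flow k t (cintegrable_Im ca)
    (congr1 (@complex.Im R) (borel_atom_mean ba)).

Let fubini_zero (F : G * G -> R) : measurable_fun [set: G * G] F ->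
  (forall z, `|F z| <= normc (flow_kernel S l Psi a z.1 z.2)) ->
  (forall x, mu.-integrable [set: G] (fun u => (F (x, u))%:E)) ->
  (forall u, \int[mu]_x (F (x, u))%:E = 0)%E ->
  measurable_fun [set: G] (fun x => \int[mu]_u F (x, u)) /\
  \int[mu]_x \int[mu]_u F (x, u) = 0.
Proof.
move=> mF Fle Fx F0; have IF := kernel_prod_integrable mF Fle.
have mm := measurable_fubini_F IF.
split; first exact: (measurableT_comp (fine_measurable measurableT) mm).
have -> : 0 = fine (\int[mu]_u \int[mu]_x (F (x, u))%:E)%E :> R.
  by under eq_integral do rewrite F0; rewrite integral0.
rewrite -(Fubini IF); congr fine; apply: eq_integral => x _.
by rewrite /Rintegral fineK//; exact: (integrable_fin_num measurableT (Fx x)).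
Qed.

Let piece_Re : measurable_fun [set: G] (fun x => complex.Re (g x)) /\
  \int[mu]_x complex.Re (g x) = 0.
Proof.
have mk := flow_kernel_measurable_Re fl hmu ml mPsi (borel_atom_Re ba)
  (borel_atom_Im ba).
apply: (fubini_zero mk) => [z|x|u]; first exact: Re_le_normc.
  exact: (cintegrable_Re (cker x)).
under eq_integral do rewrite ReM EFinB !EFinM.
have I1 := integrable_flow fl hmu hQ (l u) (cintegrable_Re ca).
have I2 := integrable_flow fl hmu hQ (l u) (cintegrable_Im ca).
rewrite integralB//; last 2 first.
- exact: (integrableZl measurableT (complex.Re (Psi u)) I1).
- exact: (integrableZl measurableT (complex.Im (Psi u)) I2).
by rewrite /= Re_mean_flow Im_mean_flow subee.
Qed.

Let piece_Im : measurable_fun [set: G] (fun x => complex.Im (g x)) /\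
  \int[mu]_x complex.Im (g x) = 0.
Proof.
have mk := flow_kernel_measurable_Im fl hmu ml mPsi (borel_atom_Re ba)
  (borel_atom_Im ba).
apply: (fubini_zero mk) => [z|x|u]; first exact: Im_le_normc.
  exact: (cintegrable_Im (cker x)).
under eq_integral do rewrite ImM EFinD !EFinM.
have I1 := integrable_flow fl hmu hQ (l u) (cintegrable_Re ca).
have I2 := integrable_flow fl hmu hQ (l u) (cintegrable_Im ca).
rewrite integralD//; last 2 first.
- exact: (integrableZl measurableT (complex.Re (Psi u)) I2).
- exact: (integrableZl measurableT (complex.Im (Psi u)) I1).
by rewrite /= Re_mean_flow Im_mean_flow adde0.
Qed.

Lemma flow_piece_integrable x : cintegrable mu [set: G]
  (flow_kernel S l Psi a x).
Proof. exact: cker. Qed.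

(** All the times l u that contribute lie in [s - delta, s]. When the value
    at x is nonzero, some S (l u) x is in the ball of a, and then S s x = S
    (s - l u) (S (l u) x) is in the double ball: so x is in one ball of
    radius rho'. The time s is the right end of the interval because then
    exp(- s) <= exp(- l u), so that the weight of Psi controls the sup norm. *)
Lemma flow_piece_atom : exists b, atom mu N K b /\
  forall x, cintegral mu (flow_kernel S l Psi a x) = Complex kappa 0 * b x.
Proof.
have [mg1 g1] := piece_Re; have [mg2 g2] := piece_Im.
have rhoQ : 0 < rho' `^ Q by rewrite powR_gt0.
pose b x := Complex kappa^-1 0 * g x.
have mb : cmeasurable b.
  split.
    rewrite (_ : (fun x => _) = (fun x => kappa^-1 * complex.Re (g x))).
      exact: measurable_funM.
    by apply/funext => x; rewrite ReM /= mul0r subr0.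
  rewrite (_ : (fun x => _) = (fun x => kappa^-1 * complex.Im (g x))).
    exact: measurable_funM.
  by apply/funext => x; rewrite ImM /= mul0r addr0.
have bgE x : g x = Complex kappa 0 * b x.
  (* If kappa = 0 then g = 0, and b = 0. *)
  rewrite /b; have [k0|k0] := eqVneq kappa 0.
    have : normc (g x) <= 0 by have := piece_bound x; rewrite k0 mul0r.
    have := normc_ge0 (g x) => n0 n1.
    have /ComplexField.Normc.eq0_normc -> : normc (g x) = 0 by apply/eqP;
      rewrite eq_le n1.
    by rewrite !mulr0.
  by apply: eqC; rewrite !(ReM, ImM) /= !mul0r ?subr0 ?addr0 mulrA
    divff// mul1r.
have nb x : normc (b x) <= (rho' `^ Q)^-1.
  rewrite /b normcM /= expr0n /= addr0 sqrtr_sqr ger0_norm ?invr_ge0//.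
  have [k0|k0] := eqVneq kappa 0.
    by rewrite k0 invr0 mul0r invr_ge0 ltW.
  have k_gt0 : 0 < kappa by rewrite lt_def k0 kappa_ge0.
  by rewrite ler_pdivrMl//; exact: piece_bound.
exists b; split; last exact: bgE.
split => //.
  by move=> x; apply: scalarM => //; exact: scalar_real.
exists (S (- s) x0), rho'; split => //.
- move=> x bx; apply: piece_support; apply: contraNneq bx => gx.
  by rewrite /b gx mulr0.
- apply/ess_supP; apply: nearW => x.
  by rewrite [X in fine X](hQ _ rho_gt0) lee_fin.
- have mg : cintegrable mu [set: G] g.
    split => //; apply: le_lt_trans (qball_L1_bound fl hmu hQ _ rho_gt0 _
      piece_support piece_bound) _ => //.
      by rewrite mulr_ge0// invr_ge0 ltW.
    by rewrite ltry.
  have -> : cintegral mu b = Complex kappa^-1 0 * cintegral mu g.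
    exact: cintegral_scale.
  by rewrite /cintegral g1 g2 mulr0.
Qed.

End pieces.

(** * Rearranged series and dominated convergence *)

Section rearranged_series.
Context {R : realType}.

(** For a fixed u the family of all pieces, enumerated by n, is the family of
    the atoms, enumerated by j, reindexed by an injection sigma depending on
    u and extended by 0: these lemmas compare the two sums. *)
Lemma nneseries_injective (sigma : nat -> nat) (gam g : nat -> \bar R) :
  injective sigma -> (forall n, 0 <= g n)%E ->
  (forall j, g (sigma j) = gam j) ->
  (forall n, (forall j, sigma j <> n) -> g n = 0%E) ->
  (\sum_(0 <= n <oo) g n = \sum_(0 <= j <oo) gam j)%E.
Proof.
move=> inj g0 gs gn; have gam0 j : (0 <= gam j)%E by rewrite -gs.
rewrite !nneseries_esumT//.
have -> : (\esum_(n in [set: nat]) g n = \esum_(n in range sigma) g n)%E.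
  rewrite [RHS]esum_mkcond; apply: eq_esum => n _; case: ifPn => // nr.
  by apply: gn => j sj; move/negP: nr; apply; rewrite inE; exists j.
rewrite (@reindex_esum _ _ _ setT (range sigma) sigma).
  by apply: eq_esum => j _; exact: gs.
by split => //; move=> i j _ _; exact: inj.
Qed.

Lemma cvg_nneseries_real (v : nat -> R) (X : R) : (forall n, 0 <= v n) ->
  (\sum_(0 <= n <oo) (v n)%:E = X%:E)%E <->
  (\sum_(i < n) v i) @[n --> \oo] --> X.
Proof.
move=> v0; have E : (fun n => (\sum_(i < n) v i)%:E) =
  (fun n => \sum_(0 <= i < n) (v i)%:E)%E.
  by apply/funext => n; rewrite -sumEFin big_mkord.
split => [vX|vX].
  have : (\sum_(0 <= i < n) (v i)%:E)%E @[n --> \oo] --> X%:E.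
    by rewrite -vX; apply: is_cvg_nneseries => n _ _; rewrite lee_fin.
  by rewrite -E => /fine_cvg.
by apply/cvg_lim => //; rewrite -E; apply: cvg_EFin => //; exact: nearW.
Qed.

Lemma abs_series_cvg (bet : nat -> R) :
  (\sum_(0 <= j <oo) `|bet j|%:E < +oo)%E ->
  exists P M : R, [/\ (\sum_(0 <= j <oo) (Num.max (bet j) 0)%:E = P%:E)%E,
   (\sum_(0 <= j <oo) (Num.max (- bet j) 0)%:E = M%:E)%E &
   (\sum_(j < n) bet j) @[n --> \oo] --> P - M].
Proof.
move=> boo.
have mx0 (x : R) : 0 <= Num.max x 0 by rewrite le_max lexx orbT.
have h (s : nat -> R) : (forall j, s j <= `|bet j|) ->
    exists P : R, (\sum_(0 <= j <oo) (Num.max (s j) 0)%:E = P%:E)%E.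
  move=> sb; exists (fine (\sum_(0 <= j <oo) (Num.max (s j) 0)%:E)%E).
  rewrite fineK// ge0_fin_numE; last by apply: nneseries_ge0 => n _ _;
    rewrite lee_fin.
  apply: le_lt_trans boo; apply: lee_nneseries => n _; first by rewrite lee_fin.
  by rewrite lee_fin ge_max sb normr_ge0.
have [P hP] := h bet (fun j => ler_norm _).
have [M hM] : exists M : R,
  (\sum_(0 <= j <oo) (Num.max (- bet j) 0)%:E = M%:E)%E.
  by apply: (h (fun j => - bet j)) => j; rewrite -normrN ler_norm.
exists P, M; split => //.
have cP := (cvg_nneseries_real P (fun n => mx0 (bet n))).1 hP.
have cM := (cvg_nneseries_real M (fun n => mx0 (- bet n))).1 hM.
have -> : (fun n => \sum_(j < n) bet j) =
  (fun n => \sum_(j < n) Num.max (bet j) 0 -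
    \sum_(j < n) Num.max (- bet j) 0).
  apply/funext => n; rewrite -sumrB; apply: eq_bigr => j _.
  by case: (ltP (bet j) 0); case: (ltP (- bet j) 0); lra.
exact: cvgB.
Qed.

Lemma cvg_series_injective (sigma : nat -> nat) (bet g : nat -> R) (B : R) :
  injective sigma -> (forall j, g (sigma j) = bet j) ->
  (forall n, (forall j, sigma j <> n) -> g n = 0) ->
  (\sum_(0 <= j <oo) `|bet j|%:E < +oo)%E ->
  (\sum_(j < n) bet j) @[n --> \oo] --> B ->
  (\sum_(i < n) g i) @[n --> \oo] --> B.
Proof.
move=> inj gs gn boo cB.
have [P [M [hP hM cPM]]] := abs_series_cvg boo.
have goo : (\sum_(0 <= j <oo) `|g j|%:E < +oo)%E.
  rewrite (nneseries_injective (gam := fun j => `|bet j|%:E) inj)//.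
  - by move=> j; rewrite gs.
  - by move=> n /gn ->; rewrite normr0.
have [P' [M' [hP' hM' cPM']]] := abs_series_cvg goo.
have mx0 (x : R) : 0 <= Num.max x 0 by rewrite le_max lexx orbT.
have PP : P = P'.
  apply: EFin_inj; rewrite -hP -hP'; apply/esym/(nneseries_injective inj).
  - by move=> n; rewrite lee_fin.
  - by move=> j; rewrite gs.
  - by move=> n /gn ->; rewrite maxxx.
have MM : M = M'.
  apply: EFin_inj; rewrite -hM -hM'; apply/esym/(nneseries_injective inj).
  - by move=> n; rewrite lee_fin.
  - by move=> j; rewrite gs.
  - by move=> n /gn ->; rewrite oppr0 maxxx.
have -> : B = P - M by exact: (cvg_unique _ cB cPM).
by rewrite PP MM.
Qed.

Lemma Re_sum (I : Type) (s : seq I) (P : pred I) (F : I -> R[i]) :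
  complex.Re (\sum_(i <- s | P i) F i) = \sum_(i <- s | P i) complex.Re (F i).
Proof. exact: (big_morph _ (@ReD R)). Qed.

Lemma Im_sum (I : Type) (s : seq I) (P : pred I) (F : I -> R[i]) :
  complex.Im (\sum_(i <- s | P i) F i) = \sum_(i <- s | P i) complex.Im (F i).
Proof. exact: (big_morph _ (@ImD R)). Qed.

Definition ccvg (w : nat -> R[i]) (z : R[i]) : Prop :=
  (fun m => normc (z - w m)) @ \oo --> (0 : R).

Lemma ccvgP (w : nat -> R[i]) (z : R[i]) : ccvg w z <->
  (complex.Re (w m) @[m --> \oo] --> complex.Re z) /\
  (complex.Im (w m) @[m --> \oo] --> complex.Im z).
Proof.
split => [h|[h1 h2]].
  have k (u : nat -> R) (t : R) : (forall m, `|t - u m| <= normc (z - w m)) ->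
      u m @[m --> \oo] --> t.
    move=> ut; apply/cvgrPdist_lt => e e0.
    move: h; rewrite /ccvg => /cvgrPdist_lt /(_ e e0); apply: filterS => m.
    by rewrite sub0r normrN ger0_norm ?normc_ge0//; exact: le_lt_trans.
  split; apply: k => m; first by rewrite -ReN -ReD Re_le_normc.
  by rewrite -ImN -ImD Im_le_normc.
apply/cvgrPdist_lt => e e0; have e20 : 0 < e / 2 by rewrite divr_gt0.
move/cvgrPdist_lt: h1 => /(_ _ e20); move/cvgrPdist_lt: h2 => /(_ _ e20).
apply: filterS2 => m m2 m1.
rewrite sub0r normrN ger0_norm ?normc_ge0//;
  apply: le_lt_trans (normc_le_ReIm _) _.
by rewrite ReD ReN ImD ImN [ltRHS]splitr ltrD.
Qed.

End rearranged_series.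

Section complete_dominated_convergence.
Context {R : realType} {d : measure_display}.

(** The limit agrees almost everywhere with a measurable upper limit. *)
Lemma ae_cvg_measurable (T : measurableType d) (mu : {measure set T -> \bar R})
    (h_ : nat -> T -> R) (h : T -> R) :
  measure_is_complete mu -> (forall n, measurable_fun [set: T] (h_ n)) ->
  {ae mu, forall u, h_ n u @[n --> \oo] --> h u} -> measurable_fun [set: T] h.
Proof.
move=> cmu mh hh.
have mL := @measurable_fun_limn_esup _ T R setT (fun n u => (h_ n u)%:E)
  (fun n => (measurable_EFinP _ _).2 (mh n)).
apply/measurable_EFinP; apply: (ae_measurable_fun cmu _ mL).
apply: filterS hh => u hu _.
have : (h_ n u)%:E @[n --> \oo] --> (h u)%:E by apply: cvg_EFin => //;
  exact: nearW.
by move=> /cvg_limn_einf_sup[_ ->].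
Qed.

Lemma Rdominated_convergence (T : measurableType d)
  (mu : {measure set T -> \bar R})
    (h_ : nat -> T -> R) (h : T -> R) (H : T -> \bar R) :
  measure_is_complete mu -> (forall n, measurable_fun [set: T] (h_ n)) ->
  {ae mu, forall u, h_ n u @[n --> \oo] --> h u} ->
  mu.-integrable [set: T] H ->
  {ae mu, forall u, forall n, (`|h_ n u|%:E <= H u)%E} ->
  mu.-integrable [set: T] (EFin \o h) /\
  (\int[mu]_u h_ n u @[n --> \oo] --> \int[mu]_u h u).
Proof.
move=> cmu mh hh iH hH; have mhl := ae_cvg_measurable cmu mh hh.
have [|||||I1 _ I2] := @dominated_convergence _ T R mu setT measurableT
  (fun n u => (h_ n u)%:E) (EFin \o h) H.
- by move=> n; exact/measurable_EFinP.
- exact/measurable_EFinP.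
- by apply: filterS hh => u hu _; apply: cvg_EFin => //; exact: nearW.
- exact: iH.
- by apply: filterS hH => u hu n _; exact: hu.
split => //; rewrite /Rintegral; apply: fine_cvg.
by rewrite fineK//; exact: (integrable_fin_num measurableT I1).
Qed.

Context {G : measTopGroupType d} (mu : {measure set G -> \bar R}).

Lemma cdominated_convergence (F_ : nat -> G -> R[i]) (F : G -> R[i])
  (H : G -> \bar R) :
  measure_is_complete mu -> (forall n, cmeasurable (F_ n)) ->
  {ae mu, forall u, ccvg (fun n => F_ n u) (F u)} ->
  mu.-integrable [set: G] H ->
  {ae mu, forall u, forall n,
    (`|complex.Re (F_ n u)|%:E <= H u)%E /\ (`|complex.Im (F_ n u)|%:E
      <= H u)%E} ->
  cintegrable mu [set: G] F /\
  ccvg (fun n => cintegral mu (F_ n)) (cintegral mu F).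
Proof.
move=> cmu mF FF iH FH.
have [I1 C1] : mu.-integrable [set: G] (EFin \o (fun u => complex.Re (F u))) /\
   (\int[mu]_u complex.Re (F_ n u) @[n --> \oo] --> \int[mu]_u
     complex.Re (F u)).
  apply: (Rdominated_convergence cmu _ _ iH).
  - by move=> n; case: (mF n).
  - by apply: filterS FF => u /ccvgP[].
  - by apply: filterS FH => u hu n; case: (hu n).
have [I2 C2] : mu.-integrable [set: G] (EFin \o (fun u => complex.Im (F u))) /\
   (\int[mu]_u complex.Im (F_ n u) @[n --> \oo] --> \int[mu]_u
     complex.Im (F u)).
  apply: (Rdominated_convergence cmu _ _ iH).
  - by move=> n; case: (mF n).
  - by apply: filterS FF => u /ccvgP[].
  - by apply: filterS FH => u hu n; case: (hu n).
split; last exact/ccvgP.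
have mF' : cmeasurable F.
  by split; apply/measurable_EFinP;
    [exact: measurable_int I1|exact: measurable_int I2].
split => //.
have := integrableD measurableT (integrable_norm I1) (integrable_norm I2).
move=> /integrableP[_]; apply: le_lt_trans.
apply: ge0_le_integral => //.
- by move=> u _; rewrite lee_fin normc_ge0.
- exact/measurable_EFinP/cmeasurable_normc.
- apply: measurableT_comp => //; case: mF' => m1 m2.
  by apply: emeasurable_funD; apply/measurable_EFinP; exact: measurableT_comp.
move=> u _ /=; rewrite lee_fin; apply: le_trans (normc_le_ReIm _) _.
exact: ler_norm.
Qed.

End complete_dominated_convergence.

(** * The atomic decomposition of the Hausdorff operator *)

Section hausdorff_decomposition.
Context {R : realType} {d : measure_display} {G : measTopGroupType d}.
Variables (S : R -> G -> G) (N : G -> R) (Q : R).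
Variable mu : {sigma_finite_measure set G -> \bar R}.
Hypothesis fl : dilation_flow S N.
Hypothesis hmu : haar_measure mu.
Hypothesis hQ : forall (x : G) (r : R), 0 < r -> mu (qball N x r) = (r `^ Q)%:E.
Variable K : set R[i].
Hypothesis hK : real_or_complex K.
Variable l : G -> R.
Hypothesis ml : measurable_fun [set: G] l.
Variable Phi : G -> R[i].
Hypothesis mPhi : cmeasurable Phi.
Hypothesis PhiK : forall u, K (Phi u).
Hypothesis wPhi : (flow_weight Q mu l Phi < +oo)%E.

Let W_ge0 := flow_weight_ge0 Q mu l.

Let weight_measurable := measurable_flow_weight Q ml.

Variables (c : nat -> R[i]) (a : nat -> G -> R[i]) (x_ : nat -> G)
  (r_ : nat -> R).
Variable f : G -> R[i].
Hypothesis cK : forall j, K (c j).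
Hypothesis ba : forall j, borel_atom mu N Q K (x_ j) (r_ j) (a j).
Hypothesis csum : (\sum_(0 <= j <oo) (normc (c j))%:E < +oo)%E.
Hypothesis fconv : {ae mu, forall x, ccvg (fun m => \sum_(j < m) c j *
  a j x) (f x)}.

Let beta x u j : R[i] := c j * flow_kernel S l Phi (a j) x u.
Let H x u : \bar R := (\sum_(0 <= j <oo) (normc (beta x u j))%:E)%E.

Let normc_betaE x u j :
  (normc (beta x u j))%:E =
    ((normc (c j))%:E * (normc (flow_kernel S l Phi (a j) x u))%:E)%E.
Proof. by rewrite /beta normcM EFinM. Qed.

Let mker j := flow_kernel_measurable_normc fl hmu ml
  mPhi (borel_atom_Re (ba j)) (borel_atom_Im (ba j)).

Let mbeta j : measurable_fun [set: G * G]
  (fun z => (normc (beta z.1 z.2 j))%:E).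
Proof.
under eq_fun do rewrite normc_betaE.
by apply: measurable_funeM; apply/measurable_EFinP; exact: mker.
Qed.

Let mbeta_x j x : measurable_fun [set: G] (fun u => (normc (beta x u j))%:E).
Proof. exact: (measurableT_comp (mbeta j) (measurable_pair1 x)). Qed.

Let H_ge0 x u : (0 <= H x u)%E.
Proof. by apply: nneseries_ge0 => j _ _; rewrite lee_fin normc_ge0. Qed.

Let mH : measurable_fun [set: G * G] (fun z => H z.1 z.2).
Proof. by apply: ge0_emeasurable_sum => // j z _ _;
  rewrite lee_fin normc_ge0. Qed.

Let mH_x x : measurable_fun [set: G] (H x).
Proof. exact: (measurableT_comp mH (measurable_pair1 x)). Qed.

Let int_H : (\int[mu]_x \int[mu]_u H x u < +oo)%E.
Proof.
have -> : (\int[mu]_x \int[mu]_u H x u =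
    \sum_(0 <= j <oo) \int[mu]_x \int[mu]_u (normc (beta x u j))%:E)%E.
  rewrite -integral_nneseries//.
  - apply: eq_integral => x _; rewrite /H integral_nneseries//.
    by move=> n u _; rewrite lee_fin normc_ge0.
  - move=> n; apply: (measurable_fun_fubini_tonelli_F
      (fun z => (normc (beta z.1 z.2 n))%:E)) => //.
    by move=> z; rewrite lee_fin normc_ge0.
  - by move=> n x _; apply: integral_ge0 => u _; rewrite lee_fin normc_ge0.
have wfin : flow_weight Q mu l Phi \is a fin_num by rewrite ge0_fin_numE.
apply: (@le_lt_trans _ _
  (\sum_(0 <= j <oo) ((fine (flow_weight Q mu l Phi))%:E *
  (normc (c j))%:E))%E).
  apply: lee_nneseries => [j _ _|j _].
    by apply: integral_ge0 => x _; apply: integral_ge0 => u _;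
      rewrite lee_fin normc_ge0.
  have -> : (\int[mu]_x \int[mu]_u (normc (beta x u j))%:E =
     (normc (c j))%:E * \int[mu]_x \int[mu]_u
       (normc (flow_kernel S l Phi (a j) x u))%:E)%E.
    rewrite -ge0_integralZl//; last 3 first.
    - apply: (measurable_fun_fubini_tonelli_F
        (fun z => (normc (flow_kernel S l Phi (a j) z.1 z.2))%:E)).
        by apply/measurable_EFinP; exact: mker.
      by move=> z; rewrite lee_fin normc_ge0.
    - by move=> x _; apply: integral_ge0 => u _; rewrite lee_fin normc_ge0.
    - by rewrite lee_fin normc_ge0.
    apply: eq_integral => x _; under eq_integral do rewrite normc_betaE.
    rewrite ge0_integralZl//; last 3 first.
    - by apply/measurable_EFinP;
        exact: (measurableT_comp (mker j) (measurable_pair1 x)).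
    - by move=> u _; rewrite lee_fin normc_ge0.
    - by rewrite lee_fin normc_ge0.
  rewrite (integral_flow_kernel_normc fl hmu hQ ml mPhi (borel_atom_Re (ba j))
    (borel_atom_Im (ba j))).
  rewrite fineK// muleC -muleA; apply: lee_wpmul2l; first exact: W_ge0.
  rewrite -[leRHS]mul1e; apply: lee_wpmul2r; first by rewrite lee_fin normc_ge0.
  exact: (borel_atom_L1 fl hmu hQ (ba j)).
rewrite nneseriesZl; last by move=> j _; rewrite lee_fin normc_ge0.
by rewrite lte_mul_pinfty// lee_fin fine_ge0.
Qed.

Let good_integrable : {ae mu, forall x, mu.-integrable [set: G] (H x)}.
Proof.
have mIH : measurable_fun [set: G] (fun x => \int[mu]_u H x u)%E.
  exact: (measurable_fun_fubini_tonelli_F (fun z => H z.1 z.2)).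
have iIH : mu.-integrable [set: G] (fun x => \int[mu]_u H x u)%E.
  apply/integrableP; split => //.
  by under eq_integral do rewrite gee0_abs ?integral_ge0//.
have := integrable_ae measurableT iIH; apply: filterS => x /(_ I) hx.
apply/integrableP; split; first exact: mH_x.
under eq_integral do rewrite gee0_abs//.
by rewrite ltey_eq hx.
Qed.

Let good_limit : {ae mu, forall x, {ae mu, forall u,
  ccvg (fun m => \sum_(j < m) beta x u j) (flow_kernel S l Phi f x u)}}.
Proof.
have := ae_flow_null fl hmu hQ ml fconv.
apply: filterS => x; apply: filterS => u /contrapT /= hu.
rewrite /ccvg; have ->
  : (fun m => normc (flow_kernel S l Phi f x u - \sum_(j < m) beta x u j)) =
  (fun m => normc (Phi u) * normc (f (S (l u) x) - \sum_(j < m) c j *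
    a j (S (l u) x))).
  apply/funext => m; rewrite -normcM mulrBr mulr_sumr; congr normc;
    congr (_ - _).
  by apply: eq_bigr => j _; rewrite /beta /flow_kernel mulrCA.
have -> : (0 : R) = normc (Phi u) * 0 by rewrite mulr0.
by apply: cvgM; [exact: cvg_cst|exact: hu].
Qed.

Variable del : nat -> R.
Hypothesis del_gt0 : forall j, 0 < del j.
Hypothesis tube_del : forall j, flow_tube S N (x_ j) (r_ j) (del j).

Let Psi (p : nat * int) (u : G) : R[i] :=
  if Num.floor (l u / del p.1) == p.2 then Phi u else 0.

Let sigma u j : nat := pickle (j, Num.floor (l u / del j)).

Let sigma_inj u : injective (sigma u).
Proof. by move=> i j /(pcan_inj pickleK)[]. Qed.

Let cell_measurable p : measurable [set u | Num.floor (l u / del p.1) == p.2].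
Proof.
have -> : [set u | Num.floor (l u / del p.1) == p.2] =
    l @^-1` `[p.2%:~R * del p.1, (p.2 + 1)%:~R * del p.1[%classic.
  apply/seteqP; split => u /=.
    move=> /eqP <-; rewrite in_itv/= -ler_pdivlMr// -ltr_pdivrMr//.
    exact: floor_itv.
  rewrite in_itv/= -ler_pdivlMr// -ltr_pdivrMr// => h.
  by apply/eqP; exact: floor_def.
by rewrite -[X in measurable X]setTI; exact: ml.
Qed.

Let mPsi p : cmeasurable (Psi p).
Proof.
have mi := @measurable_indic _ _ R setT _ (cell_measurable p).
case: mPhi => m1 m2; split.
  have -> : (fun u => complex.Re (Psi p u)) =
      (fun u => \1_[set u | Num.floor (l u / del p.1) == p.2] u *
        complex.Re (Phi u)).
    apply/funext => u; rewrite /Psi indicE; case: ifPn => h.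
      by rewrite mem_set// mul1r.
    by rewrite memNset ?mul0r//; exact/negP.
  exact: measurable_funM.
have -> : (fun u => complex.Im (Psi p u)) =
    (fun u => \1_[set u | Num.floor (l u / del p.1) == p.2] u *
      complex.Im (Phi u)).
  apply/funext => u; rewrite /Psi indicE; case: ifPn => h.
    by rewrite mem_set// mul1r.
  by rewrite memNset ?mul0r//; exact/negP.
exact: measurable_funM.
Qed.

Let PsiK p u : K (Psi p u).
Proof. by rewrite /Psi; case: ifPn => // _; exact: scalar0. Qed.

Let wPsi p : (flow_weight Q mu l (Psi p) < +oo)%E.
Proof.
apply: le_lt_trans wPhi; apply: ge0_le_integral => //.
- by move=> u _; rewrite lee_fin mulr_ge0 ?normc_ge0 ?powR_ge0.
- exact: weight_measurable.
- exact: weight_measurable.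
move=> u _; rewrite lee_fin; apply: ler_wpM2r; first exact: powR_ge0.
by rewrite /Psi; case: ifPn => // _; rewrite normc0 normc_ge0.
Qed.

Let Psi_supp p u : Psi p u != 0 ->
  (p.2 + 1)%:~R * del p.1 - del p.1 <= l u <= (p.2 + 1)%:~R * del p.1.
Proof.
rewrite /Psi; case: ifPn => [/eqP <- _|]; last by rewrite eqxx.
have /andP[h1 h2] := floor_itv (l u / del p.1).
apply/andP; split; last by rewrite -ler_pdivrMr// ltW.
by rewrite intrD mulrDl mul1r addrK -ler_pdivlMr.
Qed.

Let kap p : R := 2 `^ Q * fine (flow_weight Q mu l (Psi p)).

Let kap_ge0 p : 0 <= kap p.
Proof. by rewrite mulr_ge0 ?powR_ge0 ?fine_ge0. Qed.

Let ker_p p x : cintegrable mu [set: G] (flow_kernel S l (Psi p) (a p.1) x).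
Proof.
exact: (flow_piece_integrable fl hmu hQ ml (mPsi p) (wPsi p)
  (@Psi_supp p) (ba p.1)).
Qed.

Let atoms_p : exists b : nat * int -> G -> R[i], forall p, atom mu N K (b p) /\
  forall x, cintegral mu (flow_kernel S l (Psi p) (a p.1) x) =
    Complex (kap p) 0 * b p x.
Proof.
suff /choice[b hb] : forall p, exists b : G -> R[i], atom mu N K b /\
    forall x, cintegral mu (flow_kernel S l (Psi p) (a p.1) x) =
      Complex (kap p) 0 * b x.
  by exists b.
move=> p.
exact: (flow_piece_atom fl hmu hQ hK ml (mPsi p) (PsiK p) (wPsi p)
  (@Psi_supp p) (@tube_del p.1) (ba p.1)).
Qed.

(** The n-th piece at x, as a function of u before integration. *)
Let T x n u : R[i] := oapp (fun p => c p.1 * flow_kernel S l (Psi p)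
  (a p.1) x u) 0
  (@pickle_inv (nat * int)%type n).

Let T_sigma x u j : T x (sigma u j) u = beta x u j.
Proof. by rewrite /T /sigma pickleK_inv /= /beta /flow_kernel /Psi /= eqxx. Qed.

Let T_out x u n : (forall j, sigma u j <> n) -> T x n u = 0.
Proof.
move=> nj; rewrite /T; have := @pickle_invK (nat * int)%type n.
case: pickle_inv => //= -[j k] /= pn; rewrite /flow_kernel /Psi/=.
case: ifPn => [/eqP kE|_]; last by rewrite mul0r mulr0.
by exfalso; apply: (nj j); rewrite /sigma kE.
Qed.

Let T_series x u : (\sum_(0 <= n <oo) (normc (T x n u))%:E = H x u)%E.
Proof.
apply: (nneseries_injective (@sigma_inj u)).
- by move=> n; rewrite lee_fin normc_ge0.
- by move=> j; rewrite T_sigma.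
- by move=> n /T_out ->; rewrite normc0.
Qed.

Let T_bound x u (h : R[i] -> R) : (forall I (s : seq I) P F,
  h (\sum_(i <- s | P i) F i) = \sum_(i <- s | P i) h (F i)) ->
  (forall z, `|h z| <= normc z) ->
  forall m, (`|h (\sum_(n < m) T x n u)|%:E <= H x u)%E.
Proof.
move=> hs hn m; rewrite -(T_series x u).
apply: le_trans (nneseries_lim_ge m _); last by move=> n _ _;
  rewrite lee_fin normc_ge0.
rewrite big_mkord sumEFin lee_fin hs.
by apply: le_trans (ler_norm_sum _ _ _) _; apply: ler_sum => n _.
Qed.

Let T_ccvg x u z : (H x u < +oo)%E ->
  ccvg (fun m => \sum_(j < m) beta x u j) z ->
  ccvg (fun m => \sum_(n < m) T x n u) z.
Proof.
move=> Hoo /ccvgP[c1 c2].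
have key (h : R[i] -> R) : (forall I (s : seq I) P F,
  h (\sum_(i <- s | P i) F i) = \sum_(i <- s | P i) h (F i)) ->
  (forall z, `|h z| <= normc z) -> h 0 = 0 ->
  h (\sum_(j < m) beta x u j) @[m --> \oo] --> h z ->
  h (\sum_(n < m) T x n u) @[m --> \oo] --> h z.
  move=> hs hn h0 hb; under eq_fun do rewrite hs.
  apply: (cvg_series_injective (@sigma_inj u) (bet := fun j => h (beta x u j))
    (g := fun n => h (T x n u)) (B := h z)).
  - by move=> j; rewrite T_sigma.
  - by move=> n /T_out ->.
  - apply: le_lt_trans Hoo; apply: lee_nneseries => [j _ _|j _].
      by rewrite lee_fin.
    by rewrite lee_fin hn.
  - by under eq_fun do rewrite -hs.
apply/ccvgP; split; apply: key => //.
- exact: Re_sum.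
- exact: Re_le_normc.
- exact: Im_sum.
- exact: Im_le_normc.
Qed.

Let T_integrable x n : cintegrable mu [set: G] (T x n).
Proof.
rewrite /T; case: pickle_inv => [p|] /=; last exact: cintegrable0.
exact: cintegrable_scale.
Qed.

Let cmu : measure_is_complete mu.
Proof. by case: hmu => -[_ []]. Qed.

(** Dominated convergence, with majorant H x. *)
Let good_point x : mu.-integrable [set: G] (H x) ->
  {ae mu, forall u, ccvg (fun m => \sum_(j < m) beta x u j)
    (flow_kernel S l Phi f x u)} ->
  cintegrable mu [set: G] (flow_kernel S l Phi f x) /\
  ccvg (fun m => \sum_(n < m) cintegral mu (T x n))
    (cintegral mu (flow_kernel S l Phi f x)).
Proof.
move=> iH hlim.
have [I1 C1] : cintegrable mu [set: G] (flow_kernel S l Phi f x) /\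
  ccvg (fun m => cintegral mu (fun u => \sum_(n < m) T x n u))
    (cintegral mu (flow_kernel S l Phi f x)).
  apply: (cdominated_convergence cmu _ _ iH).
  - by move=> m; case: (cintegral_sum (T_integrable x) m) => -[].
  - have := integrable_ae measurableT iH;
      apply: filterS2 hlim => u hu /(_ I) Hu.
    by apply: T_ccvg => //; rewrite ltey_eq Hu.
  - apply: nearW => u m; split; apply: T_bound.
    + exact: Re_sum.
    + exact: Re_le_normc.
    + exact: Im_sum.
    + exact: Im_le_normc.
split => //; move: C1; rewrite /ccvg.
by under eq_fun do rewrite (cintegral_sum (T_integrable x) _).2.
Qed.

(** At a fixed u the pieces that are active correspond to the atoms, so that
    under the integral the sum over n becomes a sum over j. *)
Let weight_sum (c' : nat -> R[i]) :
  (forall n, c' n = oapp (fun p => c p.1 * Complex (kap p) 0) 0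
    (@pickle_inv (nat * int)%type n)) ->
  (\sum_(0 <= n <oo) (normc (c' n))%:E =
   (2 `^ Q)%:E * flow_weight Q mu l Phi * \sum_(0 <= j <oo) (normc (c j))%:E)%E.
Proof.
move=> c'E.
pose g n u : \bar R :=
  oapp (fun p => (normc (c p.1) * (normc (Psi p u) * expR (- l u) `^ Q))%:E)%E
  0%E
  (@pickle_inv (nat * int)%type n).
have g0 n u : (0 <= g n u)%E.
  by rewrite /g; case: pickle_inv => //= p;
    rewrite lee_fin !mulr_ge0 ?normc_ge0 ?powR_ge0.
have mg n : measurable_fun [set: G] (g n).
  rewrite /g; case: pickle_inv => //= p.
  by under eq_fun do rewrite EFinM; apply: measurable_funeM;
    exact: weight_measurable.
have E n : (normc (c' n))%:E = ((2 `^ Q)%:E * \int[mu]_u g n u)%E.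
  rewrite c'E /g; case: pickle_inv => [p|] /=; last by rewrite integral0 mule0
    expr0n/= addr0 sqrtr0.
  under eq_integral do rewrite EFinM.
  rewrite ge0_integralZl//; last 3 first.
  - exact: weight_measurable.
  - by move=> u _; rewrite lee_fin mulr_ge0 ?normc_ge0 ?powR_ge0.
  - by rewrite lee_fin normc_ge0.
  have wf : flow_weight Q mu l (Psi p) \is a fin_num by rewrite ge0_fin_numE.
  rewrite normcM /= expr0n/= addr0 sqrtr_sqr ger0_norm//.
  rewrite -[X in (_ = _ * (_ * X))%E]/(flow_weight Q mu l (Psi p))
    -(fineK wf) -!EFinM.
  by congr (_%:E); rewrite /kap mulrCA.
under eq_eseriesr do rewrite E.
rewrite nneseriesZl; last by move=> n _; exact: integral_ge0.
rewrite -integral_nneseries// -muleA; congr (_ * _)%E.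
have S0 : (0 <= \sum_(0 <= j <oo) (normc (c j))%:E)%E.
  by apply: nneseries_ge0 => j _ _; rewrite lee_fin normc_ge0.
rewrite /flow_weight -ge0_integralZr//; last 2 first.
- exact: weight_measurable.
- by move=> u _; rewrite lee_fin mulr_ge0 ?normc_ge0 ?powR_ge0.
apply: eq_integral => u _.
rewrite -nneseriesZl; last by move=> j _; rewrite lee_fin normc_ge0.
apply: (nneseries_injective (@sigma_inj u)) => //.
- by move=> j; rewrite /g /sigma pickleK_inv /= /Psi /= eqxx -EFinM mulrC.
- move=> n nj; rewrite /g; have := @pickle_invK (nat * int)%type n.
  case: pickle_inv => //= -[j k] /= pn; rewrite /Psi/=.
  case: ifPn => [/eqP kE|_]; last by rewrite normc0 mul0r mulr0.
  by exfalso; apply: (nj j); rewrite /sigma kE.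
Qed.

Let zero_atom : atom mu N K (fun=> 0).
Proof.
split; [by move=> _; exact: scalar0|by split; exact: measurable_cst|].
exists 1%g, 1; split => //.
- by move=> y /=; rewrite eqxx.
- apply/ess_supP; apply: nearW => y; rewrite normc0 lee_fin invr_ge0.
  by rewrite [X in fine X]hQ//= powR_ge0.
- exact: cintegral0.
Qed.

(** The times are cut, for every j, into intervals of length del j; the piece
    (j, k) is the part of the operator applied to a j that comes from the u
    with l u in the k-th interval. It is the atom b (j, k) times a constant,
    and the pairs (j, k) are enumerated by pickling. *)
Lemma hausdorff_atomic_decomposition_tube :
  {ae mu, forall x, cintegrable mu [set: G] (flow_kernel S l Phi f x)} /\
  exists c' a', atomic_decomposition mu N K
      (fun x => cintegral mu (flow_kernel S l Phi f x)) c' a' /\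
    (\sum_(0 <= n <oo) (normc (c' n))%:E =
     (2 `^ Q)%:E * flow_weight Q mu l Phi * \sum_(0 <= j <oo)
       (normc (c j))%:E)%E.
Proof.
have good : {ae mu, forall x, cintegrable mu [set: G]
  (flow_kernel S l Phi f x) /\
  ccvg (fun m => \sum_(n < m) cintegral mu (T x n))
    (cintegral mu (flow_kernel S l Phi f x))}.
  by move: good_integrable good_limit; apply: filterS2 => x; exact: good_point.
split; first by apply: filterS good => x [].
have [b hb] := atoms_p.
pose c' n := oapp (fun p => c p.1 * Complex (kap p) 0)
  0 (@pickle_inv (nat * int)%type n).
pose a' n := oapp b (fun=> 0) (@pickle_inv (nat * int)%type n).
have c'sum := @weight_sum c' (fun=> erefl).
exists c', a'; split; last exact: c'sum.
split.
- move=> n; rewrite /c'; case: pickle_inv => [p|] /=; last exact: scalar0.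
  by apply: scalarM => //; exact: scalar_real.
- move=> n; rewrite /a'; case: pickle_inv => [p|] /=; last exact: zero_atom.
  by case: (hb p).
- rewrite c'sum; have wf : flow_weight Q mu l Phi \is a fin_num by rewrite
    ge0_fin_numE.
  by rewrite -(fineK wf) -EFinM lte_mul_pinfty// lee_fin mulr_ge0
    ?powR_ge0 ?fine_ge0.
apply: filterS good => x [_]; rewrite /ccvg => h.
have E n : cintegral mu (T x n) = c' n * a' n x.
  rewrite /T /c' /a'; case: pickle_inv => [p|] /=;
    last by rewrite cintegral0 mul0r.
  by rewrite cintegral_scale// (hb p).2 mulrA.
by under eq_fun do under eq_bigr do rewrite -E.
Qed.

End hausdorff_decomposition.

(** * Boundedness on the Hardy space *)

Section hausdorff_bounded.
Context {R : realType} {d : measure_display} {G : measTopGroupType d}.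
Variables (S : R -> G -> G) (N : G -> R) (Q : R).
Variable mu : {sigma_finite_measure set G -> \bar R}.
Hypothesis fl : dilation_flow S N.
Hypothesis hmu : haar_measure mu.
Hypothesis hQ : forall (x : G) (r : R), 0 < r -> mu (qball N x r) = (r `^ Q)%:E.
Variable K : set R[i].
Hypothesis hK : real_or_complex K.
Variable l : G -> R.
Hypothesis ml : measurable_fun [set: G] l.
Variable Phi : G -> R[i].
Hypothesis mPhi : cmeasurable Phi.
Hypothesis PhiK : forall u, K (Phi u).
Hypothesis wPhi : (flow_weight Q mu l Phi < +oo)%E.

Let T (f : G -> R[i]) (x : G) : R[i] := cintegral mu (flow_kernel S l Phi f x).
Let M : R := 2 `^ Q * fine (flow_weight Q mu l Phi).

Let w_ge0 := flow_weight_ge0 Q mu l Phi.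

Let M_ge0 : 0 <= M. Proof. by rewrite mulr_ge0 ?powR_ge0 ?fine_ge0. Qed.

Let M_E : M%:E = ((2 `^ Q)%:E * flow_weight Q mu l Phi)%E.
Proof. by rewrite /M EFinM fineK// ge0_fin_numE. Qed.

(** Choosing Borel versions of the atoms only changes the series of f on a
    null set. *)
Lemma hausdorff_atomic_decomposition f c a : atomic_decomposition
  mu N K f c a ->
  {ae mu, forall x, cintegrable mu [set: G] (flow_kernel S l Phi f x)} /\
  exists c' a', atomic_decomposition mu N K (T f) c' a' /\
    (\sum_(0 <= n <oo) (normc (c' n))%:E = M%:E * \sum_(0 <= j <oo)
      (normc (c j))%:E)%E.
Proof.
move=> [cK aK csum fconv].
have /choice[x_ /choice[r_ /choice[b hb]]] : forall j, exists x0 r b,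
    borel_atom mu N Q K x0 r b /\ {ae mu, forall x, a j x = b x}.
  by move=> j; exact: (atom_borel_version hmu hQ hK (aK j)).
have bat j : borel_atom mu N Q K (x_ j) (r_ j) (b j) by case: (hb j).
have /choice[del hdel] : forall j, exists del, 0 < del /\ flow_tube S
  N (x_ j) (r_ j) del.
  move=> j; have [del d0 td] := flow_tube_exists fl (x_ j)
    (borel_atom_radius (bat j)).
  by exists del.
have fconv' : {ae mu, forall x, ccvg (fun m => \sum_(j < m) c j * b j x) (f x)}.
  have ab : {ae mu, forall x, forall j, a j x = b j x}.
    by apply: ae_foralln => j; case: (hb j).
  move: fconv ab; apply: filterS2 => x h abx; rewrite /ccvg.
  by under eq_fun do under eq_bigr do rewrite -abx.
have := hausdorff_atomic_decomposition_tube fl hmu hQ hK ml mPhi PhiK wPhi cK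
  bat csum fconv'
  (fun j => (hdel j).1) (fun j => (hdel j).2).
by rewrite M_E.
Qed.

Lemma hausdorff_integrable f : H1 mu N K f ->
  {ae mu, forall x, cintegrable mu [set: G] (flow_kernel S l Phi f x)}.
Proof. by move=> [_ [c [a /hausdorff_atomic_decomposition[]]]]. Qed.

Lemma hausdorff_H1 f : H1 mu N K f -> H1 mu N K (T f).
Proof.
move=> [fK [c [a ca]]]; split.
  by move=> x; apply: cintegral_scalar => // u; exact: scalarM.
by have [_ [c' [a' [h _]]]] := hausdorff_atomic_decomposition ca; exists c', a'.
Qed.

Lemma hausdorff_H1norm_le f : H1 mu N K f ->
  (H1norm mu N K (T f) <= M%:E * H1norm mu N K f)%E.
Proof.
move=> Hf.
have key c a : atomic_decomposition mu N K f c a ->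
    (H1norm mu N K (T f) <= M%:E * \sum_(0 <= j <oo) (normc (c j))%:E)%E.
  move=> /hausdorff_atomic_decomposition[_ [c' [a' [h <-]]]].
  by apply: ereal_inf_lbound; exists c', a'.
have [M0|M0] := eqVneq M 0.
  have [_ [c [a ca]]] := Hf; have := key c a ca.
  by rewrite M0 !mul0e.
have M_gt0 : 0 < M by rewrite lt_def M0.
rewrite -lee_pdivrMl//; apply: le_ereal_inf_tmp => _ [c [a [ca ->]]].
by rewrite lee_pdivrMl//; exact: key ca.
Qed.

Lemma hausdorff_ae_eq f g : H1 mu N K f -> H1 mu N K g ->
  {ae mu, forall x, f x = g x} -> {ae mu, forall x, T f x = T g x}.
Proof.
move=> Hf Hg /(ae_flow_null fl hmu hQ ml) fg.
have If := hausdorff_integrable Hf; have Ig := hausdorff_integrable Hg.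
apply: filterS3 fg If Ig => x fgx [mf _] [mg _].
apply: cintegral_ae_eq => //; apply: filterS fgx => u /contrapT /= fgu.
by rewrite /flow_kernel fgu.
Qed.

Lemma hausdorff_linear k f g : H1 mu N K f -> H1 mu N K g ->
  {ae mu, forall x, T (fun y => k * f y + g y) x = k * T f x + T g x}.
Proof.
move=> Hf Hg.
apply: filterS2 (hausdorff_integrable Hf) (hausdorff_integrable Hg) => x If Ig.
rewrite /T -cintegral_linear//; congr cintegral; apply/funext => u.
by rewrite /flow_kernel mulrDr mulrCA.
Qed.

Lemma hausdorff_bounded_operator : bounded_operator_H1 mu N K T.
Proof.
split; [exact: hausdorff_H1|exact: hausdorff_ae_eq| |].
  by move=> k f g _; exact: hausdorff_linear.
by exists M => f; exact: hausdorff_H1norm_le.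
Qed.

Lemma hausdorff_opnorm :
  (opnorm_H1 mu N K T <= (2 `^ Q)%:E * flow_weight Q mu l Phi)%E.
Proof.
rewrite -M_E; apply: ge_ereal_sup => _ [f [Hf f1 ->]].
apply: le_trans (hausdorff_H1norm_le Hf) _.
by rewrite -[leRHS]mule1; apply: lee_wpmul2l => //; rewrite lee_fin.
Qed.

End hausdorff_bounded.

(** The bundled form in which Fubini uses sigma-finiteness. *)
Lemma sigma_finite_measure_of (R : realType) d (T : measurableType d)
    (mu : {measure set T -> \bar R}) : sigma_finite [set: T] mu ->
  exists smu : {sigma_finite_measure set T -> \bar R},
    (smu : {measure set T -> \bar R}) = mu.
Proof.
move=> sfm.
pose sf1 := isSFinite.Build _ _ _ _ (sfinite_measure_sigma_finite sfm).
pose sf2 := isSigmaFinite.Build _ _ _ _ sfm.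
pose smu := HB.pack_for (SigmaFiniteMeasure.type T R) (Measure.sort mu) sf1 sf2.
by exists smu; exact: eq_measure.
Qed.

Theorem corollary2 (R : realType) (d : measure_display)
    (G : measTopGroupType d) (D : R -> G -> G) (N : G -> R) (Q : R)
    (mu : {measure set G -> \bar R}) (K : set R[i])
    (lam : G -> R) (Phi : G -> R[i])
    (hG : homogeneous_group D) (hN : homogeneous_norm D N)
    (hmu : haar_measure mu)
    (hQ : forall (x : G) (r : R), 0 < r -> mu (qball N x r) = (r `^ Q)%:E)
    (hK : real_or_complex K)
    (lam_gt0 : forall u, 0 < lam u)
    (lam_meas : measurable_fun [set: G] lam)
    (PhiK : forall u, K (Phi u))
    (Phi_loc : locally_cintegrable mu Phi)
    (Phi_L1 : (L1w_norm mu Q lam Phi < +oo)%E) :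
  (forall f, H1 mu N K f ->
     {ae mu, forall x,
       cintegrable mu [set: G] (hausdorff_integrand D Phi lam f x)}) /\
  bounded_operator_H1 mu N K (hausdorff_operator mu D Phi lam) /\
  (opnorm_H1 mu N K (hausdorff_operator mu D Phi lam)
     <= (2 `^ Q)%:E * L1w_norm mu Q lam Phi)%E.
Proof.
have fl := homogeneous_group_flow hG hN.
have [smu smuE] := sigma_finite_measure_of (haar_sigma_finite fl hmu hQ);
  subst mu.
pose l u := ln (lam u).
have lamE u : expR (l u) = lam u by rewrite lnK// posrE.
have ml : measurable_fun [set: G] l by exact: measurableT_comp.
have mPhi : cmeasurable Phi by have [] := Phi_loc set0 compact0.
have wE : flow_weight Q smu l Phi = L1w_norm smu Q lam Phi.
  apply: eq_integral => u _; congr (_ * _)%:E.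
  by rewrite -expRM mulNr expRN expRM lamE.
have wPhi : (flow_weight Q smu l Phi < +oo)%E by rewrite wE.
have kE f : flow_kernel (fun s => D (expR s)) l Phi f =
  hausdorff_integrand D Phi lam f.
  by apply/funext => x; apply/funext => u; rewrite /flow_kernel lamE.
have TE : (fun f x => cintegral smu (flow_kernel (fun s => D (expR s))
  l Phi f x)) =
    hausdorff_operator smu D Phi lam.
  by apply/funext => f; apply/funext => x; rewrite kE.
split.
  by move=> f Hf; rewrite -kE;
    exact: (hausdorff_integrable fl hmu hQ hK ml mPhi PhiK wPhi Hf).
rewrite -TE -wE; split.
  exact: (hausdorff_bounded_operator fl hmu hQ hK ml mPhi PhiK wPhi).
exact: (hausdorff_opnorm fl hmu hQ hK ml mPhi PhiK wPhi).
Qed.
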